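(* MEFE-Matching can be solved in polynomial time on instances in which the capacity of each course is one and each TA has distinct valuations for its positively valued courses (i.e., for every TA $t$ and distinct courses $x,y$ with $u_t(x)>0$ and $u_t(y)>0$, $u_t(x)\ne u_t(y)$). That is, there is a polynomial-time algorithm that, given such an instance, outputs a MEFE matching if one exists and correctly reports that none exists otherwise.
   Context: An instance of MEFE-Matching consists of: a finite set of courses $X=\{x_1,\dots,x_n\}$; a finite set of TAs $T=\{t_1,\dots,t_m\}$; for each TA $t_i$ a utility (valuation) function $u_i=u_{t_i}\colon X\to\mathbb{Z}_{\ge 0}$ and a grade function $g_i=g_{t_i}\colon X\to\mathbb{Q}_{\ge 0}$; for each course $x_i$ a capacity $c_i$ (a positive integer) and a utility (valuation) function $v_i=v_{x_i}\colon T\to\mathbb{Z}_{\ge 0}$, where for every TA $t$ and course $x_i$ one has $v_i(t)=0$ if $u_t(x_i)=0$ and $v_i(t)>0$ otherwise; and a number $k\in\mathbb{Q}_{\ge 0}$. All numbers are encoded in binary. A matching is a function $\mu\colon T\to X\cup\{\emptyset\}$, where $\mu(t)=\emptyset$ means $t$ is unassigned; by convention $u_t(\emptyset)=0$. It is feasible if $|\mu^{-1}(x_i)|=c_i$ for every course $x_i$ and no TA $t$ is assigned to a course $x$ with $u_t(x)=0$. A MEFE (merit-based envy-free egalitarian) matching is a feasible matching $\mu$ such that (1) (satisfaction of courses) for every course $x_i$, $\mathrm{AvgUtil}(x_i)=\frac{1}{c_i}\sum_{t\in\mu^{-1}(x_i)}v_i(t)\ge k$; and (2) (merit-based envy-freeness)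 there are no two TAs $t_i,t_j$ with $\mu(t_j)\in X$, $g_i(\mu(t_j))\ge g_j(\mu(t_j))$ and $u_i(\mu(t_j))>u_i(\mu(t_i))$. *)

(* Defs.v *)
From mathcomp Require Import all_boot all_order all_algebra.

Set Implicit Arguments.
Unset Strict Implicit.
Unset Printing Implicit Defensive.

Import Order.TTheory GRing.Theory Num.Theory.

(* Polynomial time is that of a random access machine with a read-only input
   tape of naturals, a write-only output tape, and the instruction set of Cook
   and Reckhow (natural-number registers, indirect addressing, no
   multiplication) extended with halving as in Papadimitriou's RAM.  Each
   instruction takes one step, and the size of an input is the number of bits
   of its binary representation.  One step lengthens the largest number in the
   machine by at most one bit, so polynomially many steps of this machine are
   polynomially many steps of a Turing machine. *)
Inductive instr : Type :=
  | Const of nat & nat          (* X_i := a *)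
  | Add of nat & nat & nat      (* X_i := X_j + X_k *)
  | Sub of nat & nat & nat      (* X_i := max(X_j - X_k, 0) *)
  | Half of nat & nat           (* X_i := floor (X_j / 2) *)
  | Fetch of nat & nat          (* X_i := X_{X_j} *)
  | Store of nat & nat          (* X_{X_i} := X_j *)
  | JumpPos of nat & nat        (* if X_i > 0 goto a *)
  | Read of nat                 (* X_i := next input, 0 if none is left *)
  | Print of nat.               (* output X_i *)

Definition program := seq instr.

Record config := Config {
  pc : nat;
  reg : nat -> nat;
  inp : seq nat;
  out : seq nat
}.

Definition upd (r : nat -> nat) (i a : nat) : nat -> nat :=
  fun j => if j == i then a else r j.

Definition exec (ins : instr) (c : config) : config :=
  let r := reg c in
  let set i a := Config (pc c).+1 (upd r i a) (inp c) (out c) in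
  match ins with
  | Const i a => set i a
  | Add i j k => set i (r j + r k)
  | Sub i j k => set i (r j - r k)
  | Half i j => set i (r j)./2
  | Fetch i j => set i (r (r j))
  | Store i j => set (r i) (r j)
  | JumpPos i a =>
      Config (if 0 < r i then a else (pc c).+1) r (inp c) (out c)
  | Read i =>
      Config (pc c).+1 (upd r i (head 0 (inp c))) (behead (inp c)) (out c)
  | Print i => Config (pc c).+1 r (inp c) (rcons (out c) (r i))
  end.

(* The machine halts when the program counter leaves the program. *)
Definition halted (p : program) (c : config) : bool := size p <= pc c.

Definition step (p : program) (c : config) : config :=
  if onth p (pc c) is Some ins then exec ins c else c.

Definition init (w : seq nat) : config := Config 0 (fun=> 0) w [::].

Definition halts_within (p : program) (w : seq nat) (t : nat) (o : seq nat)
    : Prop :=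
  let c := iter t (step p) (init w) in halted p c /\ out c = o.

(* Number of binary digits; 0 has one digit. *)
Definition bitlen (a : nat) : nat := (trunc_log 2 a).+1.

Definition bitsize (w : seq nat) : nat := sumn [seq bitlen a | a <- w].

(* The search problem with instances [I : Inst] satisfying [dom I], encoded by
   [enc], and with correct outputs [ans I], is solved in polynomial time. *)
Definition polytime_solvable (Inst : Type) (enc : Inst -> seq nat)
    (dom : Inst -> Prop) (ans : Inst -> seq nat -> Prop) : Prop :=
  exists (p : program) (a d : nat), forall I : Inst, dom I ->
    exists (t : nat) (o : seq nat),
      [/\ t <= a * bitsize (enc I) ^ d + a,
          halts_within p (enc I) t o
        & ans I o].

Record mefe_instance := MefeInstance {
  ncourses : nat;
  ntas : nat;
  util : 'I_ntas -> 'I_ncourses -> nat;      (* u_t(x) *)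
  grade : 'I_ntas -> 'I_ncourses -> rat;     (* g_t(x) *)
  cap : 'I_ncourses -> nat;                  (* c_x *)
  value : 'I_ncourses -> 'I_ntas -> nat;     (* v_x(t) *)
  threshold : rat;                           (* k *)
  grade_ge0 : forall t x, (0 <= grade t x)%R;
  cap_gt0 : forall x, 0 < cap x;
  value_eq0 : forall x t, (value x t == 0) = (util t x == 0);
  threshold_ge0 : (0 <= threshold)%R
}.

Section Matchings.

Variable I : mefe_instance.

Definition matching := 'I_(ntas I) -> option 'I_(ncourses I).

Definition outil (t : 'I_(ntas I)) (y : option 'I_(ncourses I)) : nat :=
  if y is Some x then util t x else 0.

Definition assigned (mu : matching) (x : 'I_(ncourses I)) :
    {set 'I_(ntas I)} :=
  [set t | mu t == Some x].

Definition feasible (mu : matching) : Prop :=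
  (forall x, #|assigned mu x| = cap x) /\
  (forall t x, mu t = Some x -> util t x <> 0).

Definition avg_util (mu : matching) (x : 'I_(ncourses I)) : rat :=
  ((cap x)%:R^-1 * \sum_(t in assigned mu x) (value x t)%:R)%R.

Definition courses_satisfied (mu : matching) : Prop :=
  forall x, (threshold I <= avg_util mu x)%R.

Definition merit_envy (mu : matching) (ti tj : 'I_(ntas I)) : Prop :=
  exists x, [/\ mu tj = Some x, (grade tj x <= grade ti x)%R
              & outil ti (mu ti) < util ti x].

Definition merit_envy_free (mu : matching) : Prop :=
  ~ exists ti tj, ti <> tj /\ merit_envy mu ti tj.

Definition is_mefe (mu : matching) : Prop :=
  [/\ feasible mu, courses_satisfied mu & merit_envy_free mu].

Definition unit_capacities : Prop :=
  forall x : 'I_(ncourses I), cap x = 1.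

Definition distinct_valuations : Prop :=
  forall (t : 'I_(ntas I)) (x y : 'I_(ncourses I)),
    x <> y -> 0 < util t x -> 0 < util t y -> util t x <> util t y.

Definition encode_rat (q : rat) : seq nat := [:: `|numq q|%N; `|denq q|%N].

(* Every block starts with the index of its course or TA, so that an instance
   has size at least [ncourses I + ntas I] even when one of the two sets is
   empty. *)
Definition encode_course (x : 'I_(ncourses I)) : seq nat :=
  [:: nat_of_ord x, cap x & [seq value x t | t <- enum 'I_(ntas I)]].

Definition encode_ta (t : 'I_(ntas I)) : seq nat :=
  nat_of_ord t :: [seq util t x | x <- enum 'I_(ncourses I)]
    ++ flatten [seq encode_rat (grade t x) | x <- enum 'I_(ncourses I)].

Definition encode_instance : seq nat :=
  [:: ncourses I; ntas I]
    ++ encode_rat (threshold I)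
    ++ flatten [seq encode_course x | x <- enum 'I_(ncourses I)]
    ++ flatten [seq encode_ta t | t <- enum 'I_(ntas I)].

(* 1, then for each TA 0 if unassigned and x+1 if assigned to course x. *)
Definition encode_matching (mu : matching) : seq nat :=
  1 :: [seq (if mu t is Some x then x.+1 else 0) | t <- enum 'I_(ntas I)].

Definition encode_none : seq nat := [:: 0].

Definition mefe_answer (o : seq nat) : Prop :=
  (exists mu, is_mefe mu /\ o = encode_matching mu) \/
  ((~ exists mu, is_mefe mu) /\ o = encode_none).

End Matchings.

(* Main.v *)
Require Import Defs.
From mathcomp Require Import all_boot all_order all_algebra.
From mathcomp Require Import zify.

(* Delete from [TAs x courses] the ineligible pairs and, repeatedly, every pair
   (t, x) such that some other TA s with grade at least that of t at x values x
   but has lost all the courses that she prefers to x: if t held x, then s would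
   envy t.  No MEFE matching uses a deleted pair.  When nothing more can be
   deleted, give each TA her best remaining course: by closure under deletion no
   two TAs get the same course and there is no merit-based envy, and every TA
   matched in some MEFE matching is matched.  Hence a MEFE matching exists iff
   all courses are filled, and then this assignment is one.

   Deletion is a monotone operator, so [ntas * ncourses] rounds reach its least
   fixpoint.  The rounds are written in a small language of bounded loops,
   compiled to the machine; the compiler is proved correct once for a
   weakest-precondition calculus whose side conditions bound loop counts and
   multipliers, which makes the running time polynomial. *)

Set Implicit Arguments.
Unset Strict Implicit.
Unset Printing Implicit Defensive.

Import Order.TTheory GRing.Theory Num.Theory.
(* [all_algebra] shadows instruction names such as [Sub] and [Half]. *)
Import Defs.

(** * Deletion of pairs *)

Section Deletion.

Variable I : mefe_instance.
Implicit Types (t s : 'I_(ntas I)) (x y : 'I_(ncourses I)) (mu nu : matching I).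

(** With capacity one, the average utility of a course is the valuation of its only TA, so
    satisfaction of courses becomes a condition on single pairs. *)
Definition eligible t x := (0 < util t x) && (threshold I <= (value x t)%:R)%R.

Definition pairs := {set 'I_(ntas I) * 'I_(ncourses I)}.
Implicit Types X Y : pairs.

(* If [X] contains only pairs that are in no MEFE matching, then so does
   [deletion X]: a TA [s] that cannot get anything better than [x] envies
   whoever holds [x] with at most her own grade. *)
Definition rejects X s t x :=
  [&& s != t, 0 < util s x,
      [forall y, (util s x < util s y) ==> ((s, y) \in X)]
    & (grade t x <= grade s x)%R].

Definition deletion X : pairs :=
  [set p | ~~ eligible p.1 p.2 || [exists s, rejects X s p.1 p.2]].

(** [fixset] is the iterate from [set0] taken as many times as there are pairs, so it unfolds to the
    number of rounds that the machine performs. *)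
Definition deleted : pairs := fixset deletion.

Lemma deletion_mono : {homo deletion : X Y / X \subset Y}.
Proof.
move=> X Y sXY; apply/subsetP => p; rewrite !inE => /orP[->//|/existsP[s]].
case/and4P=> st us /forallP top g; apply/orP; right; apply/existsP; exists s.
apply/and4P; split=> //; apply/forallP => y; apply/implyP => lt_y.
by apply: (subsetP sXY); apply: (implyP (top y)).
Qed.

Lemma mem_deleted t x :
  ((t, x) \in deleted) = ~~ eligible t x || [exists s, rejects deleted s t x].
Proof. by rewrite -{1}[deleted](fixsetK deletion_mono) inE. Qed.

Hypothesis cap1 : unit_capacities I.
Hypothesis distinct : distinct_valuations I.

Lemma assigned_single mu x : feasible mu ->
  exists t, assigned mu x = [set t].
Proof. by case=> card _; apply/cards1P; rewrite card cap1. Qed.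

Lemma avg_util_unit mu t x : assigned mu x = [set t] ->
  avg_util mu x = (value x t)%:R%R.
Proof. by move=> ax; rewrite /avg_util ax cap1 big_set1 invr1 mul1r. Qed.

(** The set [X] of pairs that [nu] does not use is closed under [deletion], since a TA rejecting a
    used pair would envy its holder. By monotonicity every iterate from [set0] then stays inside
    [X]. *)
Lemma mefe_notin_deleted nu t x :
  is_mefe nu -> nu t = Some x -> (t, x) \notin deleted.
Proof.
case=> feas sat envy nut.
pose X : pairs := [set p | nu p.1 != Some p.2].
suff sX: deletion X \subset X.
  have sub k : iter k deletion set0 \subset X.
    elim: k => [|k IHk]; first exact: sub0set.
    by rewrite iterS (subset_trans (deletion_mono IHk)).
  apply/negP => /(subsetP (sub _)); by rewrite inE /= nut eqxx.
apply/subsetP => -[{nut}t {}x]; rewrite !inE /=.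
apply: contraTneq => nut; rewrite negb_or negbK; apply/andP; split.
  have [s ax] := assigned_single x feas.
  have ts : t = s by apply/set1P; rewrite -ax inE nut.
  apply/andP; split; first by case: feas => _ /(_ _ _ nut)/eqP; rewrite lt0n.
  by rewrite ts -(avg_util_unit ax).
apply/existsP => -[s /and4P[st us /forallP top g]].
apply: envy; exists s, t; split; first exact/eqP.
exists x; split=> //; case nus: (nu s) => [y|//] /=.
have xy : x <> y.
  move=> exy; have [r ax] := assigned_single x feas.
  have: t \in assigned nu x by rewrite inE nut.
  have: s \in assigned nu x by rewrite inE nus exy.
  by rewrite ax => /set1P sr /set1P tr; rewrite sr tr eqxx in st.
(* The course [y] held by [s] cannot tie with [x], as valuations are distinct, nor be preferred to
   [x], as [(s, y)] would then be a pair that [nu] does not use. *)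
rewrite ltnNge; apply/negP; rewrite leq_eqVlt => /orP[/eqP e|lt_y].
  by apply: (distinct xy us _ e); rewrite -e.
by have := implyP (top y) lt_y; rewrite inE /= nus eqxx.
Qed.

(** A property rather than a function, so that it can be checked of the matching read off the final
    store. *)
Definition best_remaining mu :=
  forall t, match mu t with
  | Some x => (t, x) \notin deleted /\
              forall y, util t x < util t y -> (t, y) \in deleted
  | None => forall y, 0 < util t y -> (t, y) \in deleted
  end.

Section Best.

Variable mu : matching I.
Hypothesis best : best_remaining mu.

Lemma best_notin_deleted t x : mu t = Some x -> (t, x) \notin deleted.
Proof. by move=> mut; have := best t; rewrite mut => -[]. Qed.

Lemma best_eligible t x : mu t = Some x -> eligible t x.
Proof.
by move/best_notin_deleted; rewrite mem_deleted negb_or negbK => /andP[].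
Qed.

Lemma best_above t y : outil t (mu t) < util t y -> (t, y) \in deleted.
Proof. by have := best t; case: (mu t) => [x [_]|] /=; apply. Qed.

(** A fixpoint contains every pair that is rejected relative to it, and the pairs of [mu] survived.
    Both injectivity and envy-freeness reduce to this. *)
Lemma best_no_rejects s t x : mu t = Some x -> s != t -> 0 < util s x ->
  (forall y, util s x < util s y -> (s, y) \in deleted) ->
  (grade t x <= grade s x)%R -> False.
Proof.
move=> mut st us top g; have := best_notin_deleted mut.
rewrite mem_deleted negb_or => /andP[_ /existsP[]]; exists s.
by apply/and4P; split=> //; apply/forallP => y; apply/implyP/top.
Qed.

(** Of two holders of [x], the one with the higher or equal grade has lost everything she prefers to
    [x], so she rejects the pair of the other. *)
Lemma best_inj s t x : mu s = Some x -> mu t = Some x -> s = t.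
Proof.
wlog g : s t / (grade t x <= grade s x)%R.
  move=> H mus mut; case/orP: (le_total (grade t x) (grade s x)) => g.
    exact: H.
  by symmetry; apply: H.
move=> mus mut; apply/eqP; apply: contraT => st; exfalso.
apply: (best_no_rejects mut st _ _ g).
  by case/andP: (best_eligible mus).
by move=> y lt_y; apply: best_above; rewrite mus.
Qed.

Definition matched := [set t | mu t].

Lemma card_matched : #|matched| = \sum_x #|assigned mu x|.
Proof.
rewrite -sum1_card (partition_big (fun t => mu t) (fun o => o != None)).
  rewrite (reindex_omap Some id) => [|[]//].
  apply: eq_big => [x|x _]; first by rewrite /= eqxx.
  rewrite -sum1_card; apply: eq_bigl => t; rewrite !inE.
  by case: (mu t).
by move=> t; rewrite inE; case: (mu t).
Qed.

Lemma card_assigned_le1 x : #|assigned mu x| <= 1.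
Proof.
apply/card_le1P => t; rewrite inE => /eqP mut s; rewrite inE [in RHS]inE.
by apply/eqP/eqP => [mus|->//]; apply: best_inj mut.
Qed.

(** Each course has at most one TA, so as many matched TAs as courses forces exactly one TA per
    course. *)
Lemma best_is_mefe : #|matched| = ncourses I -> is_mefe mu.
Proof.
move=> full.
have a1 x : #|assigned mu x| = 1.
  apply/eqP; rewrite eqn_leq card_assigned_le1 /= lt0n; apply: contraT.
  rewrite negbK => /eqP ax0; suff: #|matched| < ncourses I by rewrite full ltnn.
  rewrite card_matched (bigD1 x) //= ax0 add0n -[X in _ < X]card_ord.
  rewrite [X in _ < X](cardD1 x) inE add1n ltnS -sum1_card.
  under [X in _ <= X]eq_bigl => y do rewrite !inE andbT.
  by apply: leq_sum => y _; apply: card_assigned_le1.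
have feas : feasible mu.
  split=> [x|t x /best_eligible/andP[]]; first by rewrite cap1 a1.
  by rewrite lt0n => /eqP.
split=> // [x|[s [t [st [x [mut g lt_x]]]]]].
  have [t ax] := assigned_single x feas; rewrite (avg_util_unit ax).
  have: t \in assigned mu x by rewrite ax set11.
  by rewrite inE => /eqP/best_eligible/andP[].
(* Whatever an envious [s] values above [x] also exceeds her best remaining course, hence is
   deleted; so she would reject the surviving pair [(t, x)]. *)
apply: (best_no_rejects mut _ _ _ g); first exact/eqP.
  exact: leq_ltn_trans lt_x.
by move=> y lt_y; apply: best_above; apply: ltn_trans lt_y.
Qed.

(** The holders of the courses under [nu] are distinct TAs, one per course. Their pairs under [nu]
    survive deletion, so each of them still has a course left and is matched by [mu]. *)
Lemma mefe_best_full nu : is_mefe nu -> #|matched| = ncourses I.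
Proof.
move=> Mnu; have feas : feasible nu by case: Mnu.
apply/eqP; rewrite eqn_leq card_matched; apply/andP; split.
  rewrite -[X in _ <= X]card_ord -sum1_card.
  by apply: leq_sum => x _; apply: card_assigned_le1.
have a1 x : exists t, nu t == Some x.
  have [t ax] := assigned_single x feas; exists t.
  by have: t \in assigned nu x by [rewrite ax set11]; rewrite inE.
pose f x := xchoose (a1 x).
have fP x : nu (f x) = Some x by apply/eqP/(xchooseP (a1 x)).
have f_inj : injective f by move=> x y fxy; apply: Some_inj; rewrite -!fP fxy.
rewrite -card_matched -[X in X <= _]card_ord -(card_imset _ f_inj).
apply/subset_leq_card/subsetP => _ /imsetP[x _ ->]; rewrite inE.
have := best (f x); case: (mu (f x)) => // /(_ x) notin.
have := mefe_notin_deleted Mnu (fP x); rewrite notin //.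
by case: feas => _ /(_ _ _ (fP x))/eqP; rewrite lt0n.
Qed.

Lemma best_answer : @mefe_answer I
  (if #|matched| == ncourses I then encode_matching mu else encode_none).
Proof.
case: eqP => [full|nfull].
  by left; exists mu; split; [apply: best_is_mefe|].
by right; split=> // -[nu /mefe_best_full].
Qed.

End Best.

End Deletion.

(** * A language of bounded loops *)

(** The value lies between [(x + y)^2] and [(x + y + 1)^2], the latter excluded, so it determines
    [x + y] and then [y]. It needs one multiplication and no division. *)
Definition npair x y := (x + y) * (x + y) + y.

Lemma npair_inj x y x' y' : npair x y = npair x' y' -> x = x' /\ y = y'.
Proof.
rewrite /npair => e; suff: x + y = x' + y' by lia.
by case: (ltngtP (x + y) (x' + y')) => // h; nia.
Qed.

Inductive expr : Type :=
  | Cst of nat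
  | Var of nat
  | Get of expr
  | Plus of expr & expr
  | Minus of expr & expr
  | Times of expr & expr
  | Pair of expr & expr.

(** [Unless] tests for zero because [JumpPos] skips code on a positive register; a conjunction of
    conditions then becomes a sum of truncated subtractions. *)
Inductive cmd : Type :=
  | Put of expr & expr
  | Input of expr
  | Output of expr
  | Seq of cmd & cmd
  | Unless of expr & cmd
  | For of expr & cmd.

Record state := State { store : nat -> nat; sin : seq nat; sout : seq nat }.

(* [Var j] is the index of the [j]-th innermost enclosing loop. *)
Fixpoint eval (env : seq nat) (m : nat -> nat) (e : expr) : nat :=
  match e with
  | Cst a => a
  | Var j => nth 0 env j
  | Get e => m (eval env m e)
  | Plus e1 e2 => eval env m e1 + eval env m e2
  | Minus e1 e2 => eval env m e1 - eval env m e2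
  | Times e1 e2 => eval env m e1 * eval env m e2
  | Pair e1 e2 => npair (eval env m e1) (eval env m e2)
  end.

(* The multiplication routine loops over the bits of its second operand. *)
Fixpoint bounded (N : nat) (env : seq nat) (m : nat -> nat) (e : expr) : bool :=
  match e with
  | Cst _ => true
  | Var j => j < size env
  | Get e => bounded N env m e
  | Plus e1 e2 | Minus e1 e2 => bounded N env m e1 && bounded N env m e2
  | Times e1 e2 =>
      [&& bounded N env m e1, bounded N env m e2 & eval env m e2 < 2 ^ N]
  | Pair e1 e2 => [&& bounded N env m e1, bounded N env m e2
                    & eval env m e1 + eval env m e2 < 2 ^ N]
  end.

(* Weakest precondition for running with all loop counts at most [N] and all
   multipliers below [2 ^ N]. *)
Fixpoint wp (N : nat) (c : cmd) (env : seq nat) (Q : state -> Prop) (s : state)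
    : Prop :=
  match c with
  | Put a e => bounded N env (store s) a && bounded N env (store s) e /\
      Q (State (upd (store s) (eval env (store s) a) (eval env (store s) e))
               (sin s) (sout s))
  | Input a => bounded N env (store s) a /\
      Q (State (upd (store s) (eval env (store s) a) (head 0 (sin s)))
               (behead (sin s)) (sout s))
  | Output e => bounded N env (store s) e /\
      Q (State (store s) (sin s) (rcons (sout s) (eval env (store s) e)))
  | Seq c1 c2 => wp N c1 env (wp N c2 env Q) s
  | Unless e c => bounded N env (store s) e /\
      if eval env (store s) e == 0 then wp N c env Q s else Q s
  | For e c => let k := eval env (store s) e in
      bounded N env (store s) e && (k <= N) /\
      exists J : nat -> state -> Prop,
        [/\ J 0 s,
            forall i s, i < k -> J i s -> wp N c (i :: env) (J i.+1) s
          & forall s, J k s -> Q s]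
  end.

(** * Compilation *)

(* Residues mod 4 separate temporaries, loop indices, remaining iteration counts
   and the store. *)
Definition tmp k := 4 * k.
Definition idx k := 4 * k + 1.
Definition ctr k := 4 * k + 2.
Definition cell a := 4 * a + 3.

Definition to_cell k :=
  [:: Add (tmp k) (tmp k) (tmp k); Add (tmp k) (tmp k) (tmp k);
      Const (tmp k.+1) 3; Add (tmp k) (tmp k) (tmp k.+1)].

(** Shift-and-add: [z] accumulates while [a] is doubled and [b] halved. Halving and doubling [b]
    isolates its parity, and [q] is 1 exactly when [b] is even, which skips the addition. The test
    on [b] is at offset 12, where the loop is entered. The last instruction copies [z] to [a], since
    [b] is then 0. Each segment has its only jump at the end, as [reach_block] requires. *)
Definition mul_code o k :=
  let a := tmp k in let b := tmp k.+1 in let z := tmp k.+2 in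
  let h := tmp k.+3 in let q := tmp k.+4 in
  [:: Const z 0; Const h 1; JumpPos h (o + 12)]
  ++ [:: Half h b; Add h h h; Sub h b h; Const q 1; Sub q q h;
         JumpPos q (o + 10)]
  ++ [:: Add z z a]
  ++ [:: Add a a a; Half b b]
  ++ [:: JumpPos b (o + 3)]
  ++ [:: Add a z b].

Lemma size_to_cell k : size (to_cell k) = 4.
Proof. by []. Qed.

Lemma size_mul_code o k : size (mul_code o k) = 14.
Proof. by []. Qed.

(** [d] is the number of enclosing loops, [o] the address of the first instruction and [tmp k] the
    register for the result. Loop registers are numbered from the outermost loop, hence [d - j.+1]
    for the [j]-th innermost. *)
Fixpoint cexpr (d o k : nat) (e : expr) : program :=
  let binary e1 e2 (l : nat -> program) :=
    let l1 := cexpr d o k e1 in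
    let l2 := cexpr d (o + size l1) k.+1 e2 in
    l1 ++ l2 ++ l (o + size l1 + size l2) in
  match e with
  | Cst a => [:: Const (tmp k) a]
  | Var j => [:: Const (tmp k) 0; Add (tmp k) (tmp k) (idx (d - j.+1))]
  | Get e => cexpr d o k e ++ to_cell k ++ [:: Fetch (tmp k) (tmp k)]
  | Plus e1 e2 => binary e1 e2 (fun=> [:: Add (tmp k) (tmp k) (tmp k.+1)])
  | Minus e1 e2 => binary e1 e2 (fun=> [:: Sub (tmp k) (tmp k) (tmp k.+1)])
  | Times e1 e2 => binary e1 e2 (fun o => mul_code o k)
  | Pair e1 e2 => binary e1 e2 (fun o =>
      [:: Add (tmp k.+2) (tmp k) (tmp k.+1); Add (tmp k.+3) (tmp k) (tmp k.+1)]
      ++ mul_code (o + 2) k.+2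
      ++ [:: Add (tmp k) (tmp k.+2) (tmp k.+1)])
  end.

(** A loop evaluates its bound once into [ctr d], which counts down for [JumpPos] while [idx d]
    counts up. The unconditional jump to the test at the end lets a loop run zero times. *)
Fixpoint ccmd (d o : nat) (c : cmd) : program :=
  match c with
  | Put a e => let la := cexpr d o 0 a ++ to_cell 0 in
      la ++ cexpr d (o + size la) 1 e ++ [:: Store (tmp 0) (tmp 1)]
  | Input a => cexpr d o 0 a ++ to_cell 0 ++
      [:: Read (tmp 1); Store (tmp 0) (tmp 1)]
  | Output e => cexpr d o 0 e ++ [:: Print (tmp 0)]
  | Seq c1 c2 => let l1 := ccmd d o c1 in l1 ++ ccmd d (o + size l1) c2
  | Unless e c =>
      let le := cexpr d o 0 e in
      let lc := ccmd d (o + size le).+1 c in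
      le ++ JumpPos (tmp 0) ((o + size le).+1 + size lc) :: lc
  | For e c =>
      let le := cexpr d o 0 e in
      let body := o + size le + 5 in
      let lc := ccmd d.+1 body c in
      le ++ [:: Const (tmp 1) 0; Add (ctr d) (tmp 0) (tmp 1); Const (idx d) 0;
                Const (tmp 0) 1; JumpPos (tmp 0) (body + size lc + 3)]
      ++ lc ++ [:: Const (tmp 0) 1; Add (idx d) (idx d) (tmp 0);
                   Sub (ctr d) (ctr d) (tmp 0); JumpPos (ctr d) body]
  end.

(** * Execution of code segments *)

Definition placed (p : program) o (l : program) :=
  forall i, i < size l -> onth p (o + i) = onth l i.

Lemma placed_cat p o l1 l2 :
  placed p o (l1 ++ l2) -> placed p o l1 /\ placed p (o + size l1) l2.
Proof.
move=> H; split=> i lt_i; last first.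
  by rewrite -addnA H ?size_cat ?ltn_add2l // onth_cat ltnNge leq_addr addKn.
by rewrite H ?size_cat ?ltn_addr // onth_cat lt_i.
Qed.

Lemma placed_cons p o i l :
  placed p o (i :: l) -> onth p o = Some i /\ placed p o.+1 l.
Proof.
move=> H; split=> [|j lt_j]; first by have := H 0 isT; rewrite addn0.
by rewrite addSnnS (H j.+1).
Qed.

Definition reach p T c c' := exists2 t, t <= T & iter t (step p) c = c'.

Lemma reach_refl p c : reach p 0 c c.
Proof. by exists 0. Qed.

Lemma reach_trans p T1 T2 c1 c2 c3 :
  reach p T1 c1 c2 -> reach p T2 c2 c3 -> reach p (T1 + T2) c1 c3.
Proof.
move=> [t1 h1 e1] [t2 h2 e2]; exists (t2 + t1).
  by rewrite addnC leq_add.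
by rewrite iterD e1.
Qed.

Lemma reach_leq p T T' c c' : T <= T' -> reach p T c c' -> reach p T' c c'.
Proof. by move=> h [t h1 e]; exists t => //; apply: leq_trans h. Qed.

Lemma reach_pc p T c o o' r w z : o = o' ->
  reach p T c (Config o r w z) -> reach p T c (Config o' r w z).
Proof. by move->. Qed.

Lemma reach_step p c i : onth p (pc c) = Some i -> reach p 1 c (exec i c).
Proof. by move=> e; exists 1 => //=; rewrite /step e. Qed.

Definition is_jump i := if i is JumpPos _ _ then true else false.

Lemma pc_exec i c : ~~ is_jump i -> pc (exec i c) = (pc c).+1.
Proof. by case: i. Qed.

(** Symbolic execution of straight-line code. The dummy head makes [belast] drop exactly the last
    instruction of [l], the only one allowed to jump. *)
Lemma reach_block p l c :
  placed p (pc c) l -> ~~ has is_jump (belast (Const 0 0) l) ->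
  reach p (size l) c (foldl (fun c i => exec i c) c l).
Proof.
elim: l c => [|i [|j l] IHl] c /=; first by move=> _ _; apply: reach_refl.
  by move=> /placed_cons[oi _] _; apply: reach_step.
move=> /placed_cons[oi pl]; rewrite negb_or => /andP[ji jl].
apply: (@reach_trans _ 1) (reach_step oi) _.
by apply: IHl; rewrite ?pc_exec.
Qed.

(** Evaluates reads through nested updates; residues mod 4 let [lia] decide equality of register
    numbers. *)
Ltac addresses :=
  rewrite /upd /tmp /idx /ctr /cell /=; repeat (case: eqP => ? /=; try lia).

(** The calling convention of expressions: only temporaries from [tmp k] on may change. *)
Definition keeps k (r r' : nat -> nat) :=
  forall x, (x %% 4 != 0) || (x < tmp k) -> r' x = r x.

Lemma keeps_trans k k' r1 r2 r3 :
  k <= k' -> keeps k r1 r2 -> keeps k' r2 r3 -> keeps k r1 r3.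
Proof.
move=> kk' H1 H2 x hx; rewrite H2 ?H1 //.
by move: hx; rewrite /tmp; lia.
Qed.

Lemma keeps_upd k j r a : k <= j -> keeps k r (upd r (tmp j) a).
Proof. by rewrite /keeps => kj x; addresses. Qed.

Lemma keeps_updr k j r r' a :
  k <= j -> keeps k r r' -> keeps k r (upd r' (tmp j) a).
Proof. by move=> kj H; apply: keeps_trans H (keeps_upd _ _ kj). Qed.


(** Induction on the number [N] of bits allowed for [b], starting at the test. A round preserves
    [z + a * b], halves [b] and takes at most 10 steps; the extra step is the failing test. *)
Lemma mul_loop p N o k r w z :
  placed p o (mul_code o k) -> r (tmp k.+1) < 2 ^ N ->
  exists r',
    [/\ reach p (10 * N + 1) (Config (o + 12) r w z) (Config (o + 13) r' w z),
        r' (tmp k.+1) = 0,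
        r' (tmp k.+2) = r (tmp k.+2) + r (tmp k) * r (tmp k.+1)
      & keeps k r r'].
Proof.
move=> P; have [_ /placed_cat[Pb]] := placed_cat P.
case/placed_cat=> Pz /placed_cat[Pa /placed_cat[Pj _]] {P}.
rewrite -!addnA /= in Pb Pz Pa Pj.
elim: N r => [|N IHN] r bN.
  have b0 : r (tmp k.+1) = 0 by lia.
  exists r; split; rewrite ?b0 ?(muln0 (r _)) ?addn0 //.
  have := @reach_block p _ (Config (o + 12) r w z) Pj isT.
  by rewrite /= b0 -addnS.
case: (posnP (r (tmp k.+1))) => [b0|b_gt0].
  exists r; split; rewrite ?b0 ?(muln0 (r _)) ?addn0 //.
  apply: (@reach_leq _ 1); first by lia.
  have := @reach_block p _ (Config (o + 12) r w z) Pj isT.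
  by rewrite /= b0 -addnS.
have R1 := @reach_block p _ (Config (o + 12) r w z) Pj isT.
rewrite /= b_gt0 in R1.
have R2 := @reach_block p _ (Config (o + 3) r w z) Pb isT.
rewrite /= in R2.
set r1 := upd _ (tmp k.+4) (upd _ _ _ _ - _) in R2.
have r1a : r1 (tmp k) = r (tmp k) by rewrite /r1; addresses.
have r1b : r1 (tmp k.+1) = r (tmp k.+1) by rewrite /r1; addresses.
have r1z : r1 (tmp k.+2) = r (tmp k.+2) by rewrite /r1; addresses.
have r1q : r1 (tmp k.+4) = ~~ odd (r (tmp k.+1)) by rewrite /r1; addresses.
have k1 : keeps k r r1 by do ![apply: keeps_updr => /=; first by lia].
rewrite r1q lt0b in R2.
(* The registers at offset 10, where the odd and the even case meet again. *)
pose r2 := if odd (r (tmp k.+1))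
  then upd r1 (tmp k.+2) (r1 (tmp k.+2) + r1 (tmp k)) else r1.
have R3 : reach p 7 (Config (o + 3) r w z) (Config (o + 10) r2 w z).
  rewrite /r2; case: (odd _) R2 => R2; last exact: (reach_leq _ R2).
  apply: reach_trans (R2) _; rewrite -!addnS.
  by have := @reach_block p _ (Config (o + 9) r1 w z) Pz isT; rewrite /= -addnS.
have r2a : r2 (tmp k) = r (tmp k).
  by rewrite /r2; case: odd => //; rewrite -r1a; addresses.
have r2b : r2 (tmp k.+1) = r (tmp k.+1).
  by rewrite /r2; case: odd => //; rewrite -r1b; addresses.
have r2z : r2 (tmp k.+2) = r (tmp k.+2) + r (tmp k) * odd (r (tmp k.+1)).
  by rewrite /r2; case: odd; rewrite ?muln0 ?muln1 ?addn0 -?r1a -r1z; addresses.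
have k2 : keeps k r r2.
  by rewrite /r2; case: odd => //; apply: keeps_updr => //; lia.
have R4 := @reach_block p _ (Config (o + 10) r2 w z) Pa isT.
rewrite /= -!addnS in R4.
set r3 := upd _ _ _ in R4.
have r3a : r3 (tmp k) = r (tmp k) + r (tmp k) by rewrite /r3 -!r2a; addresses.
have r3b : r3 (tmp k.+1) = (r (tmp k.+1))./2 by rewrite /r3 -!r2b; addresses.
have r3z : r3 (tmp k.+2) = r2 (tmp k.+2) by rewrite /r3; addresses.
have k3 : keeps k r r3 by do ![apply: keeps_updr => //=; try lia].
have [|r' [R5 b' z' k']] := IHN r3.
  by rewrite r3b -divn2 ltn_divLR // -expnSr.
exists r'; split=> //.
- apply: (@reach_leq _ (1 + (7 + (2 + (10 * N + 1))))); first by lia.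
  by do 3![apply: reach_trans; first by eassumption].
- rewrite z' r3z r2z r3a r3b -[in RHS](odd_double_half (r (tmp k.+1))); lia.
- exact: keeps_trans k3 k'.
Qed.

Lemma mul_code_sound p N o k r w z :
  placed p o (mul_code o k) -> r (tmp k.+1) < 2 ^ N ->
  exists r',
    [/\ reach p (10 * N + 5) (Config o r w z) (Config (o + 14) r' w z),
        r' (tmp k) = r (tmp k) * r (tmp k.+1) & keeps k r r'].
Proof.
move=> P bN; have [Pi] := placed_cat P; do 4!case/placed_cat=> _.
rewrite -!addnA /= => Pe.
have R1 := @reach_block p _ (Config o r w z) Pi isT.
rewrite /= in R1; set r1 := upd (upd _ _ _) _ _ in R1.
have r1a : r1 (tmp k) = r (tmp k) by rewrite /r1; addresses.
have r1b : r1 (tmp k.+1) = r (tmp k.+1) by rewrite /r1; addresses.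
have r1z : r1 (tmp k.+2) = 0 by rewrite /r1; addresses.
have r1h : r1 (tmp k.+3) = 1 by rewrite /r1; addresses.
have k1 : keeps k r r1 by do ![apply: keeps_updr => //=; try lia].
rewrite r1h /= in R1.
have [|r2 [R2 b2 z2 k2]] := @mul_loop p N o k r1 w z P; first by rewrite r1b.
have R3 := @reach_block p _ (Config (o + 13) r2 w z) Pe isT.
rewrite /= -addnS in R3; set r3 := upd _ _ _ in R3.
exists r3; split.
- apply: (@reach_leq _ (3 + (10 * N + 1 + 1))); first by lia.
  by do 2![apply: reach_trans; first by eassumption].
- by rewrite /r3 /upd eqxx b2 z2 r1a r1b r1z addn0.
- by apply: keeps_updr => //; apply: keeps_trans k1 k2.
Qed.

Lemma to_cell_sound p o k r w z :
  placed p o (to_cell k) ->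
  exists r', [/\ reach p 4 (Config o r w z) (Config (o + 4) r' w z),
                 r' (tmp k) = cell (r (tmp k)) & keeps k r r'].
Proof.
move=> P; have R := @reach_block p _ (Config o r w z) P isT.
rewrite /to_cell /= in R; set r' := upd _ _ _ in R; exists r'; split.
- by rewrite !addnS addn0.
- by rewrite /r'; addresses.
- by do ![apply: keeps_updr => //=; try lia].
Qed.

(* Soundness of compiled expressions *)
Local Opaque to_cell mul_code.

(** [env] lists the innermost index first, whereas registers are numbered from the outermost loop;
    hence the reversal. *)
Definition agrees (env : seq nat) (m r : nat -> nat) :=
  (forall j, j < size env -> r (idx (size env - j.+1)) = nth 0 env j) /\
  (forall a, r (cell a) = m a).

Lemma agrees_keeps k env m r r' :
  keeps k r r' -> agrees env m r -> agrees env m r'.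
Proof.
move=> K [Hi Hm]; split=> [j lt_j|a]; rewrite K ?Hi ?Hm //.
  by rewrite /idx; lia.
by rewrite /cell; lia.
Qed.

Fixpoint ecost (N : nat) (e : expr) : nat :=
  match e with
  | Cst _ => 1
  | Var _ => 2
  | Get e => ecost N e + 5
  | Plus e1 e2 | Minus e1 e2 => ecost N e1 + ecost N e2 + 1
  | Times e1 e2 => ecost N e1 + ecost N e2 + (10 * N + 5)
  | Pair e1 e2 => ecost N e1 + ecost N e2 + (10 * N + 8)
  end.

Definition cexpr_spec N env m e := forall p o k r w z,
  bounded N env m e -> placed p o (cexpr (size env) o k e) -> agrees env m r ->
  exists r',
    [/\ reach p (ecost N e) (Config o r w z)
          (Config (o + size (cexpr (size env) o k e)) r' w z),
        r' (tmp k) = eval env m e & keeps k r r'].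

(** The second operand is compiled to use temporaries from [k.+1] on only, so the value of the first
    one survives in [tmp k]. *)
Lemma cexpr_binary N env m e1 e2 p o k r w z (l : nat -> program) :
  let l1 := cexpr (size env) o k e1 in
  let l2 := cexpr (size env) (o + size l1) k.+1 e2 in
  let o' := o + size l1 + size l2 in
  cexpr_spec N env m e1 -> cexpr_spec N env m e2 ->
  bounded N env m e1 -> bounded N env m e2 ->
  placed p o (l1 ++ l2 ++ l o') -> agrees env m r ->
  exists r',
    [/\ reach p (ecost N e1 + ecost N e2) (Config o r w z) (Config o' r' w z),
        r' (tmp k) = eval env m e1, r' (tmp k.+1) = eval env m e2,
        keeps k r r' & placed p o' (l o')].
Proof.
move=> l1 l2 o' S1 S2 B1 B2 /placed_cat[P1 /placed_cat[P2 P3]] A.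
have [r1 [R1 v1 K1]] := S1 p o k r w z B1 P1 A.
have [r2 [R2 v2 K2]] := S2 p _ k.+1 r1 w z B2 P2 (agrees_keeps K1 A).
exists r2; split=> //.
- exact: reach_trans R1 R2.
- by rewrite K2 // /tmp; lia.
- exact: keeps_trans K1 K2.
Qed.

Lemma cexpr_sound N env m e : cexpr_spec N env m e.
Proof.
elim: e => [a|j|e IH|e1 IH1 e2 IH2|e1 IH1 e2 IH2|e1 IH1 e2 IH2|e1 IH1 e2 IH2]
  p o k r w z /=.
- move=> _ P A; exists (upd r (tmp k) a); split.
  + by rewrite addn1; have := @reach_block p _ (Config o r w z) P isT.
  + by addresses.
  + exact: keeps_upd.
- move=> lt_j P [Ai Am]; have := @reach_block p _ (Config o r w z) P isT.
  rewrite /= -(addn2 o) => R; eexists; split; first exact: R.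
  + by rewrite -Ai //; addresses.
  + by do ![apply: keeps_updr => //=].
- move=> B /placed_cat[P1 /placed_cat[P2 P3]] A.
  have [r1 [R1 v1 K1]] := IH p o k r w z B P1 A.
  have [r2 [R2 v2 K2]] := to_cell_sound r1 w z P2.
  have R3 := @reach_block p _ (Config _ r2 w z) P3 isT.
  rewrite /= -addnS -addnA in R3.
  have [_ A2] := agrees_keeps K2 (agrees_keeps K1 A).
  eexists; split.
  + rewrite !size_cat size_to_cell /= addnA.
    apply: reach_trans R1 _; apply: reach_trans R2 _; rewrite -addnA; exact: R3.
  + by rewrite /upd eqxx v2 A2 v1.
  + by apply: keeps_updr => //; apply: keeps_trans K1 K2.
- case/andP=> B1 B2 P A.
  have [r1 [R1 v1 v2 K1 {}P]] := 
    cexpr_binary (l := fun=> [:: Add _ _ _]) w z IH1 IH2 B1 B2 P A.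
  have R2 := @reach_block p _ (Config _ r1 w z) P isT.
  rewrite /= in R2; eexists; split.
  + by apply: reach_pc (reach_trans R1 R2); rewrite !size_cat /=; lia.
  + by rewrite /upd eqxx v1 v2.
  + exact: keeps_updr.
- case/andP=> B1 B2 P A.
  have [r1 [R1 v1 v2 K1 {}P]] := 
    cexpr_binary (l := fun=> [:: Sub _ _ _]) w z IH1 IH2 B1 B2 P A.
  have R2 := @reach_block p _ (Config _ r1 w z) P isT.
  rewrite /= in R2; eexists; split.
  + by apply: reach_pc (reach_trans R1 R2); rewrite !size_cat /=; lia.
  + by rewrite /upd eqxx v1 v2.
  + exact: keeps_updr.
- case/and3P=> B1 B2 B3 P A.
  have [r1 [R1 v1 v2 K1 {}P]] :=
    cexpr_binary (l := fun o => mul_code o k) w z IH1 IH2 B1 B2 P A.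
  have [|r2 [R2 v3 K2]] := mul_code_sound w z P (N := N) (r := r1).
    by rewrite v2.
  exists r2; split.
  + by apply: reach_pc (reach_trans R1 R2); rewrite !size_cat /=; lia.
  + by rewrite v3 v1 v2.
  + exact: keeps_trans K1 K2.
case/and3P=> B1 B2 B3 P A.
have [r1 [R1 v1 v2 K1 {}P]] := cexpr_binary (l := fun o =>
  [:: Add (tmp k.+2) (tmp k) (tmp k.+1); Add (tmp k.+3) (tmp k) (tmp k.+1)]
  ++ mul_code (o + 2) k.+2 ++ [:: Add (tmp k) (tmp k.+2) (tmp k.+1)])
  w z IH1 IH2 B1 B2 P A.
move: P => /(@placed_cat _ _ [:: _; _])[P2 /placed_cat[P3 P4]].
have R2 := @reach_block p _ (Config _ r1 w z) P2 isT.
rewrite /= in R2; set r2 := upd _ (tmp k.+3) _ in R2.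
move/(reach_pc (esym (addn2 _))): R2 => R2.
(* The sum and its square live above both operands, so the second one is still in [tmp k.+1] for the
   final addition. *)
have K2 : keeps k.+2 r1 r2 by do ![apply: keeps_updr => //=].
have r2v j : j < 2 -> r2 (tmp (k + j)) = r1 (tmp (k + j)).
  by move=> lt_j; rewrite /r2; addresses.
have v3 : r2 (tmp k.+2) = eval env m e1 + eval env m e2.
  by rewrite -v1 -v2 /r2; addresses.
have v4 : r2 (tmp k.+3) = eval env m e1 + eval env m e2.
  by rewrite -v1 -v2 /r2; addresses.
have [|r3 [R3 v5 K3]] := mul_code_sound w z P3 (N := N) (r := r2).
  by rewrite v4.
have R4 := @reach_block p _ (Config _ r3 w z) P4 isT.
rewrite /= in R4; eexists; split.
- apply: (@reach_leq _ (ecost N e1 + ecost N e2 + (2 + (10 * N + 5 + 1)))).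
    by lia.
  apply: reach_trans R1 _; apply: reach_trans R2 _; apply: reach_trans R3 _.
  by apply: reach_pc R4; rewrite !size_cat /= size_cat size_mul_code /=; lia.
- by rewrite /upd eqxx v5 v3 v4 K3 ?K2 ?v2 //; rewrite /tmp; lia.
- apply: keeps_updr => //.
  by apply: keeps_trans K1 (keeps_trans (leqnn _) K2 K3); lia.
Qed.

(** * Soundness of compiled commands *)

Fixpoint ccost (N : nat) (c : cmd) : nat :=
  match c with
  | Put a e => ecost N a + 4 + ecost N e + 1
  | Input a => ecost N a + 4 + 2
  | Output e => ecost N e + 1
  | Seq c1 c2 => ccost N c1 + ccost N c2
  | Unless e c => ecost N e + 1 + ccost N c
  | For e c => ecost N e + 5 + (N * (ccost N c + 4) + 1)
  end.

(** Commands may change the store, and [agrees] already fixes the indices of the enclosing loops;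
    only their counters remain to be protected. *)
Definition keeps_ctr d (r r' : nat -> nat) :=
  forall j, j < d -> r' (ctr j) = r (ctr j).

Lemma keeps_keeps_ctr k d r r' : keeps k r r' -> keeps_ctr d r r'.
Proof. by move=> K j _; rewrite K // /ctr; lia. Qed.

Lemma agrees_store env m r a v :
  agrees env m r -> agrees env (upd m a v) (upd r (cell a) v).
Proof.
case=> Ai Am; split=> [j lt_j|b]; first by rewrite -Ai //; addresses.
by rewrite /upd -Am; addresses.
Qed.

Definition ccmd_spec N c := forall p env Q s o r,
  wp N c env Q s -> placed p o (ccmd (size env) o c) ->
  agrees env (store s) r ->
  exists r' s',
    [/\ reach p (ccost N c) (Config o r (sin s) (sout s))
          (Config (o + size (ccmd (size env) o c)) r' (sin s') (sout s')),
        agrees env (store s') r', keeps_ctr (size env) r r' & Q s'].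

(** Induction on the number [n] of remaining rounds, starting at the test. The 4 steps added to the
    body are the test and the three instructions that update [idx d] and [ctr d]. *)
Lemma for_loop N c p env Q (J : nat -> state -> Prop) body k n i s r :
  ccmd_spec N c ->
  let d := size env in let lc := ccmd d.+1 body c in
  let test := body + size lc + 3 in
  placed p body (lc ++
    [:: Const (tmp 0) 1; Add (idx d) (idx d) (tmp 0);
        Sub (ctr d) (ctr d) (tmp 0); JumpPos (ctr d) body]) ->
  (forall i s, i < k -> J i s -> wp N c (i :: env) (J i.+1) s) ->
  (forall s, J k s -> Q s) ->
  i + n = k -> J i s -> r (idx d) = i -> r (ctr d) = n ->
  agrees env (store s) r ->
  exists r' s',
    [/\ reach p (n * (ccost N c + 4) + 1) (Config test r (sin s) (sout s))
          (Config test.+1 r' (sin s') (sout s')),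
        agrees env (store s') r', keeps_ctr d r r' & Q s'].
Proof.
move=> Sc d lc test P Jstep Jend.
have [Pc] := placed_cat P; case/(@placed_cat _ _ [:: _; _; _]) => Pi Pj.
elim: n i s r => [|n IHn] i s r ik Ji ri rr A.
  exists r, s; split=> //; last by apply: Jend; rewrite -ik addn0.
  have := @reach_block p _ (Config _ r (sin s) (sout s)) Pj isT.
  by rewrite /= rr.
have R1 := @reach_block p _ (Config _ r (sin s) (sout s)) Pj isT.
rewrite /= rr /= in R1.
have A1 : agrees (i :: env) (store s) r.
  case: A => Ai Am; split=> // -[_|j lt_j] /=; first by rewrite subn1.
  by rewrite subSS Ai.
have lt_i : i < k by lia.
have [r2 [s2 [R2 [A2i A2m] K2 J2]]] := Sc p _ _ _ _ _ (Jstep _ _ lt_i Ji) Pc A1.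
have R3 := @reach_block p _ (Config _ r2 (sin s2) (sout s2)) Pi isT.
rewrite /= in R3; set r3 := upd _ (ctr d) _ in R3.
have idx_d : r2 (idx d) = i.
  by have := A2i 0 isT; rewrite /= subn1.
have [|||||r4 [s4 [R4 A4 K4 Q4]]] := IHn i.+1 s2 r3.
- by rewrite addSnnS.
- by [].
- by rewrite /r3 -idx_d; addresses.
- have e : r2 (ctr d) = n.+1 by rewrite K2.
  by rewrite /r3; move: e; addresses.
- split=> [j lt_j|a]; last by rewrite -A2m /r3; addresses.
  have := A2i j.+1; rewrite /= subSS => <- //; rewrite -/d in lt_j *.
  by rewrite /r3; addresses.
exists r4, s4; split=> //.
  apply: (@reach_leq _ (1 + (ccost N c + (3 + (n * (ccost N c + 4) + 1))))).
    by rewrite mulSn; lia.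
  apply: reach_trans R1 _; apply: reach_trans R2 _.
  by apply: reach_trans (reach_pc (esym (addn3 _)) R3) R4.
move=> j lt_j; rewrite K4 // -(K2 j) ?ltnS 1?ltnW //.
by rewrite /r3; addresses.
Qed.

Lemma ccmd_sound N c : ccmd_spec N c.
Proof.
elim: c => [a e|a|e|c1 IH1 c2 IH2|e c IH|e c IH] p env Q s o r /=.
- case=> /andP[Ba Be] Qs /placed_cat[/placed_cat[P1 P2]].
  set o' := o + size (_ ++ _) => /placed_cat[P3 P4] A.
  have [r1 [R1 v1 K1]] := cexpr_sound (sin s) (sout s) Ba P1 A.
  have [r2 [R2 v2 K2]] := to_cell_sound r1 (sin s) (sout s) P2.
  have {}R2 := reach_trans R1 R2.
  rewrite -addnA -(size_to_cell 0) -size_cat -/o' in R2.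
  have A2 := agrees_keeps K2 (agrees_keeps K1 A).
  have [r3 [R3 v3 K3]] := cexpr_sound (sin s) (sout s) Be P3 A2.
  have R4 := @reach_block p _ (Config _ r3 (sin s) (sout s)) P4 isT.
  rewrite /= in R4; eexists; eexists; split; last exact: Qs.
  + apply: reach_trans (reach_trans R2 R3) _.
    apply: reach_pc R4.
    by rewrite (size_cat (_ ++ _)) addnA -/o' size_cat addnA addn1.
  + rewrite /= v3 (K3 (tmp 0)) // v2 v1; apply: agrees_store.
    exact: agrees_keeps K3 A2.
  + move=> j lt_j; rewrite (K3 (tmp 0)) // v2.
    rewrite -(keeps_keeps_ctr K1 lt_j) -(keeps_keeps_ctr K2 lt_j).
    by rewrite -(keeps_keeps_ctr K3 lt_j); addresses.
- case=> Ba Qs /placed_cat[P1 /placed_cat[P2 P3]] A.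
  have [r1 [R1 v1 K1]] := cexpr_sound (sin s) (sout s) Ba P1 A.
  have [r2 [R2 v2 K2]] := to_cell_sound r1 (sin s) (sout s) P2.
  have A2 := agrees_keeps K2 (agrees_keeps K1 A).
  have R3 := @reach_block p _ (Config _ r2 (sin s) (sout s)) P3 isT.
  have e0 x : upd r2 (tmp 1) x (tmp 0) = cell (eval env (store s) a).
    by rewrite -v1 -v2; addresses.
  have e1 x : upd r2 (tmp 1) x (tmp 1) = x by addresses.
  rewrite /= in R3; eexists; eexists; split; last exact: Qs.
  + rewrite !size_cat ?size_to_cell /=.
    apply: reach_trans; last first.
      by apply: reach_pc R3; rewrite size_to_cell; lia.
    exact: reach_trans R1 R2.
  + rewrite e0 e1; apply: agrees_store.
    by apply: agrees_keeps A2; apply: (@keeps_upd 1).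
  + move=> j lt_j.
    rewrite -(keeps_keeps_ctr K1 lt_j) -(keeps_keeps_ctr K2 lt_j).
    by rewrite e0 e1; addresses.
- case=> Be Qs /placed_cat[P1 P2] A.
  have [r1 [R1 v1 K1]] := cexpr_sound (sin s) (sout s) Be P1 A.
  have R2 := @reach_block p _ (Config _ r1 (sin s) (sout s)) P2 isT.
  rewrite /= v1 in R2; exists r1; eexists; split; last exact: Qs.
  + by apply: reach_pc (reach_trans R1 R2); rewrite size_cat addnA addn1.
  + exact: agrees_keeps K1 A.
  + exact: keeps_keeps_ctr K1.
- move=> W /placed_cat[P1 P2] A.
  have [r1 [s1 [R1 A1 K1 Q1]]] := IH1 _ _ _ _ _ _ W P1 A.
  have [r2 [s2 [R2 A2 K2 Q2]]] := IH2 _ _ _ _ _ _ Q1 P2 A1.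
  exists r2, s2; split=> //; last by move=> j lt_j; rewrite K2 ?K1.
  by rewrite size_cat addnA; apply: reach_trans R1 R2.
- set le := cexpr _ _ _ e; set o' := (o + size le).+1; set lc := ccmd _ _ c.
  case=> Be W /placed_cat[P1 P2] A.
  have [r1 [R1 v1 K1]] := cexpr_sound (sin s) (sout s) Be P1 A.
  have [P3 P4] := @placed_cat _ _ [:: _] _ P2.
  have R2 := @reach_block p _ (Config _ r1 (sin s) (sout s)) P3 isT.
  have A1 := agrees_keeps K1 A.
  rewrite /= v1 in R2.
  have -> : o + size (le ++ JumpPos (tmp 0) (o' + size lc) :: lc) =
      o' + size lc.
    by rewrite size_cat /= !addnS addnA.
  case: (posnP (eval env (store s) e)) W R2 => _ W R2.
    rewrite addn1 in P4; have [r2 [s2 [R3 A2 K2 Q2]]] := IH _ _ _ _ _ _ W P4 A1.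
    exists r2, s2; split=> //.
      by apply: reach_trans R3; apply: reach_trans R1 R2.
    by move=> j lt_j; rewrite K2 // (keeps_keeps_ctr K1 lt_j).
  exists r1, s; split=> //; last exact: keeps_keeps_ctr K1.
  by apply: reach_leq (reach_trans R1 R2); lia.
case=> /andP[Be leN] [J [J0 Jstep Jend]] /placed_cat[P1].
case/(@placed_cat _ _ [:: _; _; _; _; _]) => P2 P3 A.
have [r1 [R1 v1 K1]] := cexpr_sound (sin s) (sout s) Be P1 A.
have R2 := @reach_block p _ (Config _ r1 (sin s) (sout s)) P2 isT.
rewrite /= in R2; set r2 := upd _ (tmp 0) 1 in R2.
have A2 : agrees env (store s) r2.
  have [A1 A1m] := agrees_keeps K1 A; split=> [j lt_j|a].
    by rewrite -A1 // /r2; addresses.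
  by rewrite -A1m // /r2; addresses.
have [||r3 [s3 [R3 A3 K3 Q3]]] := for_loop IH P3 Jstep Jend (add0n _) J0 _ _ A2.
- by rewrite /r2; addresses.
- by rewrite -v1 /r2; addresses.
exists r3, s3; split=> //.
- apply: reach_trans; first exact: reach_trans R1 R2.
  rewrite size_cat; apply: reach_pc (reach_leq _ R3).
    by rewrite /= size_cat /=; lia.
  by rewrite leq_add2r leq_mul2r leN orbT.
- move=> j lt_j; rewrite K3 // -(keeps_keeps_ctr K1 lt_j) /r2; addresses.
Qed.

(** * Polynomial bounds *)

(** The base [N.+1] is positive, so exponents may be raised freely, even at [N = 0]. *)
Definition polybounded (f : nat -> nat) :=
  exists A D, forall N, f N <= A * N.+1 ^ D.

Lemma polybounded_const a : polybounded (fun=> a).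
Proof. by exists a, 0 => N; rewrite muln1. Qed.

Lemma polybounded_id : polybounded id.
Proof. by exists 1, 1 => N; rewrite mul1n expn1. Qed.

Lemma polyboundedD f g :
  polybounded f -> polybounded g -> polybounded (fun N => f N + g N).
Proof.
move=> [A [D Hf]] [A' [D' Hg]]; exists (A + A'), (D + D') => N.
rewrite mulnDl expnD; apply: leq_add.
  apply: leq_trans (Hf N) _; rewrite leq_mul2l leq_pmulr ?orbT //.
  by rewrite expn_gt0.
apply: leq_trans (Hg N) _; rewrite leq_mul2l leq_pmull ?orbT //.
by rewrite expn_gt0.
Qed.

Lemma polyboundedM f g :
  polybounded f -> polybounded g -> polybounded (fun N => f N * g N).
Proof.
move=> [A [D Hf]] [A' [D' Hg]]; exists (A * A'), (D + D') => N.
by rewrite expnD mulnACA leq_mul.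
Qed.

Ltac polybounded := repeat first
  [ exact: polybounded_const | exact: polybounded_id | assumption
  | apply: polyboundedD | apply: polyboundedM ].

Lemma ecost_polybounded e : polybounded (ecost^~ e).
Proof. by elim: e => *; rewrite /=; polybounded. Qed.

Lemma ccost_polybounded c : polybounded (ccost^~ c).
Proof.
by elim: c => * /=; polybounded; apply: ecost_polybounded.
Qed.

Lemma leq_exp_base d x y : x <= y -> x ^ d <= y ^ d.
Proof. by case: d => // d; rewrite leq_exp2r. Qed.

Lemma polytime_of_cmd (Inst : Type) (enc : Inst -> seq nat)
    (dom : Inst -> Prop) (ans : Inst -> seq nat -> Prop) (c : cmd) (b : nat) :
  (forall I, dom I -> wp (b * (bitsize (enc I)).+1 ^ 2) c [::]
     (fun s => ans I (sout s)) (State (fun=> 0) (enc I) [::])) ->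
  polytime_solvable enc dom ans.
Proof.
move=> H; have [A [D cost]] := ccost_polybounded c.
(* For positive [S], [S.+1 <= 2 * S] gives [N.+1 <= b.+1 * 4 * S ^ 2], whence the coefficient and
   the exponent [2 * D]; for [S = 0] the additive constant suffices. *)
exists (ccmd 0 0 c), (A * (b.+1 * 4) ^ D), (2 * D) => I dI.
set S := bitsize (enc I); set N := b * S.+1 ^ 2.
have P : placed (ccmd 0 0 c) 0 (ccmd (size ([::] : seq nat)) 0 c) by [].
have A0 : agrees [::] (fun=> 0) (fun=> 0) by [].
have [r [s [[t le_t run] _ _ ans_s]]] := ccmd_sound (H I dI) P A0.
exists t, (sout s); split=> //; last first.
  by rewrite /halts_within /init run /halted /= add0n leqnn.
apply: leq_trans le_t _; apply: leq_trans (cost _) _.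
have [S0|S_gt0] := posnP S.
  apply: leq_trans (leq_addl _ _); rewrite leq_mul2l; apply/orP; right.
  by apply: leq_exp_base; rewrite /N -/S S0; lia.
apply: leq_trans (leq_addr _ _); rewrite -mulnA leq_mul2l expnM -expnMn.
apply/orP; right; apply: leq_exp_base; rewrite /N.
have: S.+1 <= 2 * S by lia.
move/(leq_exp_base 2); rewrite expnMn => le_S.
have: 0 < S ^ 2 by rewrite expn_gt0 S_gt0.
by nia.
Qed.

(** * Comparison of nonnegative rationals by cross multiplication *)

Lemma grade_leE (p q : rat) : (0 <= p)%R -> (0 <= q)%R ->
  (p <= q)%R = (`|numq p| * `|denq q| <= `|numq q| * `|denq p|)%N.
Proof.
by move=> p0 q0; rewrite [LHS]le_ratE -lez_nat !PoszM !gez0_abs ?numq_ge0 //.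
Qed.

Lemma threshold_leE (k : rat) v : (0 <= k)%R ->
  (k <= v%:R)%R = (`|numq k| <= v * `|denq k|)%N.
Proof.
move=> k0; rewrite grade_leE ?ler0n //.
by rewrite pmulrn numq_int denq_int muln1 absz_nat.
Qed.

(** * The program *)

Local Notation "c1 ;; c2" := (Seq c1 c2) (at level 61, right associativity).

(** The store is a family of tables with tag [a]; injectivity of pairing keeps their cells apart. *)
Definition loc a e1 e2 := Pair (Cst a) (Pair e1 e2).

Definition num_courses := loc 0 (Cst 0) (Cst 0).
Definition num_tas := loc 1 (Cst 0) (Cst 0).
Definition thr_num := loc 2 (Cst 0) (Cst 0).
Definition thr_den := loc 3 (Cst 0) (Cst 0).
Definition scratch := loc 4 (Cst 0) (Cst 0).
Definition counter := loc 5 (Cst 0) (Cst 0).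
Definition val_at x t := loc 6 x t.
Definition util_at t x := loc 7 t x.
Definition gnum_at t x := loc 8 t x.
Definition gden_at t x := loc 9 t x.
Definition deleted_at t x := loc 10 t x.
Definition top_at t := loc 11 t (Cst 0).
Definition match_at t := loc 12 t (Cst 0).

(** [scratch] takes the index that opens each block and the capacity of each course. *)
Definition read_input :=
  Input num_courses ;; Input num_tas ;; Input thr_num ;; Input thr_den ;;
  For (Get num_courses)
    (Input scratch ;; Input scratch ;;
     For (Get num_tas) (Input (val_at (Var 1) (Var 0)))) ;;
  For (Get num_tas)
    (Input scratch ;;
     For (Get num_courses) (Input (util_at (Var 1) (Var 0))) ;;
     For (Get num_courses)
       (Input (gnum_at (Var 1) (Var 0)) ;; Input (gden_at (Var 1) (Var 0)))).

(** The guard vanishes exactly when the pair is not deleted and its utility exceeds the current top.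
    As the top starts at 0, courses of utility 0 are never chosen. Courses are stored shifted by
    one, as in the output. *)
Definition find_best :=
  For (Get num_tas)
    (Put (top_at (Var 0)) (Cst 0) ;;
     Put (match_at (Var 0)) (Cst 0) ;;
     For (Get num_courses)
       (Unless (Plus (Get (deleted_at (Var 1) (Var 0)))
                     (Minus (Plus (Get (top_at (Var 1))) (Cst 1))
                            (Get (util_at (Var 1) (Var 0)))))
          (Put (top_at (Var 1)) (Get (util_at (Var 1) (Var 0))) ;;
           Put (match_at (Var 1)) (Plus (Var 0) (Cst 1))))).

(* The guards of the two [Unless] are 0 exactly when the pair is eligible,
   resp. rejected by the TA [Var 0]. *)
Definition delete_pairs :=
  For (Get num_tas) (For (Get num_courses)
    (Put (deleted_at (Var 1) (Var 0)) (Cst 1) ;;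
     Unless (Plus (Minus (Cst 1) (Get (util_at (Var 1) (Var 0))))
                  (Minus (Get thr_num)
                         (Times (Get (val_at (Var 0) (Var 1))) (Get thr_den))))
       (Put (deleted_at (Var 1) (Var 0)) (Cst 0) ;;
        For (Get num_tas)
          (Unless (Plus (Plus
              (Minus (Cst 1)
                 (Plus (Minus (Var 0) (Var 2)) (Minus (Var 2) (Var 0))))
              (Minus (Cst 1) (Get (util_at (Var 0) (Var 1)))))
              (Plus
              (Minus (Get (top_at (Var 0))) (Get (util_at (Var 0) (Var 1))))
              (Minus (Times (Get (gnum_at (Var 2) (Var 1)))
                            (Get (gden_at (Var 0) (Var 1))))
                     (Times (Get (gnum_at (Var 0) (Var 1)))
                            (Get (gden_at (Var 2) (Var 1)))))))
             (Put (deleted_at (Var 2) (Var 1)) (Cst 1)))))).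

(** [scratch] receives the distance between the number of matched TAs and the number of courses; the
    last two [Unless] branch on whether it is 0. *)
Definition print_answer :=
  Put counter (Cst 0) ;;
  For (Get num_tas)
    (Unless (Minus (Cst 1) (Get (match_at (Var 0))))
       (Put counter (Plus (Get counter) (Cst 1)))) ;;
  Put scratch (Plus (Minus (Get counter) (Get num_courses))
                    (Minus (Get num_courses) (Get counter))) ;;
  Unless (Get scratch)
    (Output (Cst 1) ;; For (Get num_tas) (Output (Get (match_at (Var 0))))) ;;
  Unless (Minus (Cst 1) (Get scratch)) (Output (Cst 0)).

Definition solver :=
  read_input ;;
  For (Times (Get num_tas) (Get num_courses)) (find_best ;; delete_pairs) ;;
  find_best ;;
  print_answer.

(** * Rules for weakest preconditions *)

Local Notation pr a i j := (npair a (npair i j)).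

Lemma npair_eq x y x' y' : (npair x y == npair x' y') = (x == x') && (y == y').
Proof.
apply/eqP/andP => [/npair_inj[-> ->]//|[/eqP-> /eqP->]//].
Qed.

Lemma wp_for k J N e c env Q s :
  bounded N env (store s) e -> eval env (store s) e = k -> k <= N -> J 0 s ->
  (forall (i : 'I_k) s, J i s -> wp N c ((i : nat) :: env) (J i.+1) s) ->
  (forall s, J k s -> Q s) ->
  wp N (For e c) env Q s.
Proof.
move=> Be ek leN J0 Jstep Jend /=; split; first by rewrite Be ek.
exists J; rewrite ek; split=> // i s' lt_i; exact: (Jstep (Ordinal lt_i)).
Qed.

Section Rules.

Variables (N : nat) (env : seq nat) (Q : state -> Prop) (s : state).

Lemma wp_seq c1 c2 :
  wp N c1 env (wp N c2 env Q) s -> wp N (c1 ;; c2) env Q s.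
Proof. by []. Qed.

Lemma wp_put a e :
  bounded N env (store s) a -> bounded N env (store s) e ->
  Q (State (upd (store s) (eval env (store s) a) (eval env (store s) e))
           (sin s) (sout s)) ->
  wp N (Put a e) env Q s.
Proof. by move=> Ba Be; rewrite /= Ba. Qed.

Lemma wp_input a v w : bounded N env (store s) a -> sin s = v :: w ->
  Q (State (upd (store s) (eval env (store s) a) v) w (sout s)) ->
  wp N (Input a) env Q s.
Proof. by move=> Ba e; rewrite /= Ba e. Qed.

Lemma wp_output e : bounded N env (store s) e ->
  Q (State (store s) (sin s) (rcons (sout s) (eval env (store s) e))) ->
  wp N (Output e) env Q s.
Proof. by move=> Be; rewrite /= Be. Qed.

Lemma wp_unless e c : bounded N env (store s) e ->
  (eval env (store s) e = 0 -> wp N c env Q s) ->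
  (0 < eval env (store s) e -> Q s) ->
  wp N (Unless e c) env Q s.
Proof.
by move=> Be H0 H1; rewrite /=; split=> //; case: posnP.
Qed.

End Rules.

Lemma ltn_ordS k (i j : 'I_k) : (j < i.+1) = (j == i) || (j < i).
Proof. by rewrite ltnS leq_eqVlt. Qed.

Lemma exists_ordS k (P : pred 'I_k) (i : 'I_k) :
  [exists j : 'I_k, (j < i.+1) && P j] =
  [exists j : 'I_k, (j < i) && P j] || P i.
Proof.
apply/existsP/orP => [[j]|[/existsP[j]|Pi]].
- rewrite ltn_ordS => /andP[/orP[/eqP->|lt_j] Pj]; first by right.
  by left; apply/existsP; exists j; rewrite lt_j.
- by case/andP=> lt_j Pj; exists j; rewrite ltn_ordS lt_j orbT.
- by exists i; rewrite ltnSn.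
Qed.

Lemma drop_enum_ord k (i : 'I_k) :
  drop i (enum 'I_k) = i :: drop i.+1 (enum 'I_k).
Proof. by rewrite (drop_nth i) ?size_enum_ord // nth_ord_enum. Qed.

Lemma take_enum_ord k (i : 'I_k) :
  take i.+1 (enum 'I_k) = rcons (take i (enum 'I_k)) i.
Proof. by rewrite (take_nth i) ?size_enum_ord // nth_ord_enum. Qed.

Lemma drop_enum_oversize k : drop k (enum 'I_k) = [::].
Proof. by rewrite drop_oversize // size_enum_ord. Qed.

(** * Correctness of the solver *)

Section Correctness.

Local Opaque npair.

Variables (I : mefe_instance) (N : nat).

Local Notation n := (ncourses I).
Local Notation m := (ntas I).
Implicit Types (t : 'I_m) (x : 'I_n) (h : nat -> nat) (s : state).

(** These are the multiplier bounds of the two nested pairings in an address, 12 being the largest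
    tag. The hypotheses below bound the loop counts and the second factors of the products, which
    are denominators or [ncourses I]. *)
Hypothesis small : forall a i j, a <= 12 -> i <= m + n -> j <= m + n ->
  (i + j < 2 ^ N) && (a + npair i j < 2 ^ N).
Hypothesis small_rounds : (m * n <= N) && (m + n <= N).
Hypothesis small_den : forall t x, `|denq (grade t x)|%N < 2 ^ N.
Hypothesis small_thr_den : `|denq (threshold I)|%N < 2 ^ N.

Lemma small_tas : m <= N. Proof. by have := small_rounds; lia. Qed.
Lemma small_courses : n <= N. Proof. by have := small_rounds; lia. Qed.
Lemma tas_index t : t <= m + n.
Proof. by have := ltn_ord t; lia. Qed.
Lemma courses_index x : x <= m + n.
Proof. by have := ltn_ord x; lia. Qed.
Hint Resolve small_tas small_courses tas_index courses_index : core.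

Lemma bounded_loc env h a e1 e2 : a <= 12 ->
  bounded N env h e1 -> bounded N env h e2 ->
  eval env h e1 <= m + n -> eval env h e2 <= m + n ->
  bounded N env h (loc a e1 e2).
Proof.
move=> ha b1 b2 h1 h2; rewrite /= b1 b2.
by case/andP: (small ha h1 h2) => -> ->.
Qed.

Lemma bounded_get env h e : bounded N env h e -> bounded N env h (Get e).
Proof. by []. Qed.

Lemma bounded_plus env h e1 e2 :
  bounded N env h e1 -> bounded N env h e2 -> bounded N env h (Plus e1 e2).
Proof. by move=> b1 b2; rewrite /= b1. Qed.

Lemma bounded_minus env h e1 e2 :
  bounded N env h e1 -> bounded N env h e2 -> bounded N env h (Minus e1 e2).
Proof. by move=> b1 b2; rewrite /= b1. Qed.

Lemma bounded_times env h e1 e2 :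
  bounded N env h e1 -> bounded N env h e2 -> eval env h e2 < 2 ^ N ->
  bounded N env h (Times e1 e2).
Proof. by move=> b1 b2 h2; rewrite /= b1 b2. Qed.

Local Arguments bounded : simpl never.
Local Arguments wp : simpl never.

Ltac bounds := repeat first
  [ by rewrite /= | apply: bounded_loc | apply: bounded_get
  | apply: bounded_plus | apply: bounded_minus | apply: bounded_times
  | apply/andP; split ].

Ltac put := first [apply: wp_put | apply: wp_seq; apply: wp_put];
  [by bounds | by bounds | rewrite /=].

Definition header h := [/\ h (pr 0 0 0) = n, h (pr 1 0 0) = m,
  h (pr 2 0 0) = `|numq (threshold I)|%N
  & h (pr 3 0 0) = `|denq (threshold I)|%N].

Definition values_loaded c h :=
  forall x t, x < c -> h (pr 6 x t) = value x t.

Definition tas_loaded c h := forall t x, t < c ->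
  [/\ h (pr 7 t x) = util t x, h (pr 8 t x) = `|numq (grade t x)|%N
    & h (pr 9 t x) = `|denq (grade t x)|%N].

Definition loaded h := [/\ header h, values_loaded n h & tas_loaded m h].

(** The input occupies the tags 0 to 3 and 6 to 9; all others are working space. *)
Lemma loaded_upd h a i j v :
  (3 < a) && ((a < 6) || (9 < a)) -> loaded h -> loaded (upd h (pr a i j) v).
Proof.
move=> ha [[H0 H1 H2 H3] HV HT].
have upd_ne b i' j' : b != a ->
    upd h (pr a i j) v (pr b i' j') = h (pr b i' j').
  by move=> ne; rewrite /upd npair_eq (negbTE ne).
split=> [|x t lt_x|t x lt_t].
- by split; rewrite upd_ne //; lia.
- by rewrite upd_ne ?HV //; lia.
- by have [h7 h8 h9] := HT t x lt_t; split; rewrite upd_ne //; lia.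
Qed.

Definition marks (X : pairs I) h := forall t x, h (pr 10 t x) = ((t, x) \in X).

(** Invariant of a maximum search: a bound on the first [c] courses, and a course attaining it
    unless it is 0. *)
Definition best_at (X : pairs I) h t c :=
  (forall y : 'I_n, y < c -> (t, y) \notin X -> util t y <= h (pr 11 t 0)) /\
  ((h (pr 11 t 0) = 0 /\ h (pr 12 t 0) = 0) \/
   exists x, [/\ (t, x) \notin X, 0 < util t x, h (pr 11 t 0) = util t x
               & h (pr 12 t 0) = x.+1]).

Lemma wp_find_best env Q s X :
  loaded (store s) -> marks X (store s) ->
  (forall s', loaded (store s') -> marks X (store s') ->
     (forall t, best_at X (store s') t n) ->
     sout s' = sout s -> Q s') ->
  wp N find_best env Q s.
Proof.
move=> L M HQ.
pose J c s' := [/\ loaded (store s'), marks X (store s'),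
  forall t, t < c -> best_at X (store s') t n & sout s' = sout s].
apply: (@wp_for m J).
- by bounds.
- by case: L => -[].
- exact: small_tas.
- by split.
- move=> t s1 [L1 M1 B1 O1]; put; put.
  set h1 := upd _ _ _.
  pose J' c s' := [/\ loaded (store s'), marks X (store s'),
    forall t', t' < t -> best_at X (store s') t' n, best_at X (store s') t c
    & sout s' = sout s].
  have L2 : loaded h1 by do 2!apply: loaded_upd => //.
  apply: (@wp_for n J') => //=.
  + by bounds.
  + by case: L2 => -[].
  + split=> //=.
    * by move=> t' x; rewrite /h1 /upd !npair_eq; apply: M1.
    * move=> t' lt_t'; rewrite /best_at /h1 /upd !npair_eq /=.
      by rewrite ltn_eqF //=; apply: B1.
    * by split=> //; left; rewrite /h1 /upd !npair_eq !eqxx.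
  + move=> x s2 [L3 M3 B3 [T3 T3'] O3].
    have [_ _ /(_ t x (ltn_ord t))[U3 _ _]] := L3.
    apply: wp_unless; rewrite /= ?U3 ?M3; first by bounds.
      move=> e0; have lt_u : store s2 (pr 11 t 0) < util t x by lia.
      have tx : (t, x) \notin X by move: e0; case: (_ \in _).
      put; put; set h2 := upd _ _ _.
      split=> /=; [by do 2!apply: loaded_upd => // | | | |by []].
      * by move=> t' x'; rewrite /h2 /upd !npair_eq; apply: M3.
      * move=> t' lt_t'; rewrite /best_at /h2 /upd !npair_eq /=.
        by rewrite ltn_eqF //=; apply: B3.
      * rewrite /best_at /h2 /upd !npair_eq !eqxx /= U3; split.
          move=> y; rewrite ltn_ordS => /orP[/eqP->//|lt_y] ty.
          exact: leq_trans (T3 y lt_y ty) (ltnW lt_u).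
        by right; exists x; split=> //; [lia | rewrite addn1].
    move=> e0; split=> //; split=> // y.
    rewrite ltn_ordS => /orP[/eqP->|lt_y] ty; last exact: T3.
    by move: e0; rewrite (negbTE ty); lia.
  + move=> s3 [L3 M3 B3 T3 O3]; split=> // t'.
    by rewrite ltn_ordS => /orP[/eqP->//|]; apply: B3.
- by move=> s' [L' M' B' O']; apply: HQ => // t; apply: B'.
Qed.

(** Turns the quantifier in [rejects] into a single comparison with the recorded top. *)
Lemma top_leE X h t x : best_at X h t n -> 0 < util t x ->
  (h (pr 11 t 0) <= util t x) =
  [forall y, (util t x < util t y) ==> ((t, y) \in X)].
Proof.
case=> top best u_gt0; apply/idP/forallP => [le_x y|above].
  apply/implyP => lt_y; apply: contraLR lt_y => ty; rewrite -leqNgt.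
  exact: leq_trans (top y (ltn_ord y) ty) le_x.
rewrite leqNgt; apply/negP => lt_x; case: best => [[e _]|[y [ty _ e _]]].
  by rewrite e in lt_x.
by move: ty; rewrite (implyP (above y)) // -e.
Qed.

Lemma eligibleE t x : eligible t x = (0 < util t x) &&
  (`|numq (threshold I)| <= value x t * `|denq (threshold I)|).
Proof. by rewrite /eligible threshold_leE ?threshold_ge0. Qed.

(** Marks are overwritten in place, but the guards read only the input tables and the tops recorded
    by [find_best]. Hence the whole pass computes [deletion X] for the set [X] at the start of the
    round. *)
Lemma wp_delete_pairs env Q s X :
  loaded (store s) -> (forall t, best_at X (store s) t n) ->
  (forall s', loaded (store s') -> marks (deletion X) (store s') ->
     sout s' = sout s -> Q s') ->
  wp N delete_pairs env Q s.
Proof.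
move=> L B HQ.
pose marked h t x := h (pr 10 t x) = ((t, x) \in deletion X).
pose inv i j s' := [/\ loaded (store s'), forall t, best_at X (store s') t n,
  forall t x, t < i -> marked (store s') t x,
  forall t x, t = i :> nat -> x < j -> marked (store s') t x
  & sout s' = sout s].
(* The invariant speaks only of marks before position [(i, j)], so writing there is harmless. *)
have inv_upd i j v s1 : inv i j s1 ->
    inv i j (State (upd (store s1) (pr 10 i j) v) (sin s1) (sout s1)).
  move=> [L1 B1 M1 M1' O1]; split=> //=.
  - exact: loaded_upd.
  - by move=> t; rewrite /best_at /upd !npair_eq; apply: B1.
  - move=> t x lt_t; rewrite /marked /upd !npair_eq (ltn_eqF lt_t) /=.
    exact: M1.
  - move=> t x et lt_x; rewrite /marked /upd !npair_eq (ltn_eqF lt_x) !andbF.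
    exact: M1'.
apply: (@wp_for m (inv^~ 0)).
- by bounds.
- by case: L => -[].
- exact: small_tas.
- by split=> // t x _.
- move=> t s1 inv1; have [[H1 V1 T1] _ _ _ _] := inv1.
  apply: (@wp_for n (inv t)) => //=.
  + by bounds.
  + by case: H1.
  move=> x s2 inv2; apply: wp_seq; apply: wp_put; [by bounds|by bounds|].
  have {inv2} := inv_upd _ _ 1 _ inv2; rewrite /=.
  set h2 := upd _ _ _ => inv2.
  have h2tx : h2 (pr 10 t x) = 1 by rewrite /h2 /upd eqxx.
  have [[H2 V2 T2] B2 M2 M2' O2] := inv2.
  rewrite /= in H2 V2 T2 B2 M2 M2'.
  have [U2 _ _] := T2 t x (ltn_ord t).
  have step s3 : inv t x s3 -> marked (store s3) t x -> inv t x.+1 s3.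
    move=> [L3 B3 M3 M3' O3] m3; split=> // t' x' et.
    move: (ord_inj et) => {et}->.
    by rewrite ltn_ordS => /orP[/eqP->//|]; apply: M3'.
  apply: wp_unless; rewrite /=.
  + by bounds => /=; case: H2 => _ _ _ ->.
  + case: H2 => _ _ -> ->; rewrite U2 V2 // => e0.
    have tx : eligible t x by rewrite eligibleE; lia.
    apply: wp_seq; apply: wp_put; [by bounds|by bounds|].
    have {inv2} := inv_upd _ _ 0 _ inv2; rewrite /=.
    set h3 := upd _ _ _ => inv3.
    pose J c s' := inv t x s' /\ store s' (pr 10 t x) =
      [exists s : 'I_m, (s < c) && rejects X s t x].
    apply: (@wp_for m J).
    * by bounds.
    * by case: inv3 => -[[]].
    * exact: small_tas.
    * split=> //=; rewrite /h3 /upd eqxx -[LHS]/(nat_of_bool false).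
      by congr nat_of_bool; apply/esym/existsP => -[s'].
    * move=> r s4 [inv4 e4]; have [[H4 V4 T4] B4 _ _ _] := inv4.
      have [Ut nt dt] := T4 t x (ltn_ord t).
      have [Ur nr dr] := T4 r x (ltn_ord r).
      (* Each summand must vanish: [1 - a = 0] says that [a] is positive, and [r - t + (t - r)] is
         the distance between the two indices. The grades are compared by cross multiplication. *)
      have guard : (1 - (r - t + (t - r)) + (1 - util r x) +
          (store s4 (pr 11 r 0) - util r x +
           (`|numq (grade t x)|%N * `|denq (grade r x)|%N -
            `|numq (grade r x)|%N * `|denq (grade t x)|%N)) == 0) =
          rejects X r t x.
        rewrite /rejects grade_leE ?grade_ge0 // 2!addn_eq0 !subn_eq0.
        have -> : (0 < r - t + (t - r)) = (r != t) by rewrite -val_eqE /=; lia.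
        rewrite -!andbA; congr andb; case: posnP => //= u_gt0.
        by rewrite addn_eq0 !subn_eq0 (top_leE (B4 r) u_gt0).
      apply: wp_unless; rewrite /= ?Ut ?nt ?dt ?Ur ?nr ?dr.
      - by bounds => /=; rewrite ?dr ?dt.
      - move/eqP; rewrite guard => rej.
        apply: wp_put; [by bounds|by bounds|].
        split; first exact: inv_upd.
        by rewrite /= /upd eqxx exists_ordS rej orbT.
      - rewrite lt0n guard => rej; split=> //.
        by rewrite e4 exists_ordS (negbTE rej) orbF.
    * move=> s4 [inv4 e4]; apply: step => //.
      rewrite /marked e4 inE /= tx /=; congr (nat_of_bool _).
      by apply: eq_existsb => s'; rewrite ltn_ord.
  + case: H2 => _ _ -> ->; rewrite U2 V2 // => e0.
    apply: step => //; rewrite /marked /= h2tx inE /=.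
    by rewrite eligibleE -[RHS]/(_ || _ : nat); lia.
  + move=> s3 [L3 B3 M3 M3' O3]; split=> // t' x'.
    rewrite ltn_ordS => /orP[/eqP->|]; last exact: M3.
    exact: M3'.
- move=> s3 [L3 _ M3 _ O3]; apply: HQ => // t x.
  exact: M3.
Qed.

(** Serves both the valuations of a course and the utilities of a TA; the frame condition confines
    changes to row [i] of table [a]. *)
Lemma wp_input_row a k (f : 'I_k -> nat) e i env Q s rest :
  a <= 12 -> i <= m + n -> k <= N -> k <= m + n ->
  bounded N (i :: env) (store s) e -> eval (i :: env) (store s) e = k ->
  sin s = [seq f j | j <- enum 'I_k] ++ rest ->
  (forall h, (forall j : 'I_k, h (pr a i j) = f j) ->
     (forall b i' j' : nat, (b != a) || (i' != i) ->
        h (pr b i' j') = store s (pr b i' j')) ->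
     Q (State h rest (sout s))) ->
  wp N (For e (Input (loc a (Var 1) (Var 0)))) (i :: env) Q s.
Proof.
move=> ha hi kN hk Be ek Sin HQ.
pose J c s' := [/\ sin s' = [seq f j | j <- drop c (enum 'I_k)] ++ rest,
  sout s' = sout s, forall j : 'I_k, j < c -> store s' (pr a i j) = f j
  & forall b i' j' : nat, (b != a) || (i' != i) ->
      store s' (pr b i' j') = store s (pr b i' j')].
apply: (@wp_for k J) => //.
- by split=> //; rewrite Sin drop0.
- move=> j s1 [S1 O1 R1 F1].
  apply: (wp_input (v := f j)); last first.
  + split=> /=; [reflexivity | exact: O1 | |].
    * move=> j'; rewrite ltn_ordS /upd !npair_eq !eqxx /= => /orP[/eqP->|lt_j].
        by rewrite eqxx.
      by rewrite (ltn_eqF lt_j) R1.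
    * move=> b i' j' ne; rewrite /upd !npair_eq andbA -[_ && _ && _]negbK.
      by rewrite !negb_and ne /= F1.
  + by rewrite S1 drop_enum_ord.
  + by bounds => //=; have := ltn_ord j; lia.
- move=> s1 [S1 O1 R1 F1]; rewrite drop_enum_oversize /= in S1.
  case: s1 S1 O1 R1 F1 => h1 w1 o1 /= -> -> R1 F1.
  by apply: HQ => // j; apply: R1.
Qed.

Lemma wp_input_grades t env Q s rest :
  header (store s) ->
  sin s = flatten [seq encode_rat (grade t x) | x <- enum 'I_n] ++ rest ->
  (forall h, (forall x, h (pr 8 t x) = `|numq (grade t x)|%N) ->
     (forall x, h (pr 9 t x) = `|denq (grade t x)|%N) ->
     (forall b i' j' : nat, (b < 8) || (9 < b) || (i' != t) ->
        h (pr b i' j') = store s (pr b i' j')) ->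
     Q (State h rest (sout s))) ->
  wp N (For (Get num_courses)
         (Input (gnum_at (Var 1) (Var 0)) ;; Input (gden_at (Var 1) (Var 0))))
    ((t : nat) :: env) Q s.
Proof.
move=> H Sin HQ.
pose J c s' := [/\ sin s' = flatten [seq encode_rat (grade t x)
    | x <- drop c (enum 'I_n)] ++ rest, sout s' = sout s,
  forall x, x < c -> store s' (pr 8 t x) = `|numq (grade t x)|%N /\
    store s' (pr 9 t x) = `|denq (grade t x)|%N
  & forall b i' j' : nat, (b < 8) || (9 < b) || (i' != t) ->
      store s' (pr b i' j') = store s (pr b i' j')].
apply: (@wp_for n J) => //.
- by bounds.
- by case: H.
- by split=> //; rewrite Sin drop0.
- move=> x s1 [S1 O1 R1 F1]; rewrite drop_enum_ord /= in S1.
  apply: wp_seq; apply: (wp_input _ S1); first by bounds.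
  apply: wp_input; [by bounds | reflexivity | ].
  split=> //=.
  + move=> y; rewrite ltn_ordS /upd !npair_eq !eqxx /= => /orP[/eqP->|lt_y].
      by rewrite eqxx.
    by rewrite (ltn_eqF lt_y); apply: R1.
  + move=> b i' j' ne; rewrite /upd !npair_eq -F1 //.
    have ne89 d : 7 < d < 10 -> (b == d) && ((i' == t) && (j' == x)) = false.
      by move=> hd; lia.
    by rewrite !ne89.
- move=> s1 [S1 O1 R1 F1]; rewrite drop_enum_oversize /= in S1.
  case: s1 S1 O1 R1 F1 => h1 w1 o1 /= -> -> R1 F1.
  by apply: HQ => // x; have [] := R1 x (ltn_ord x).
Qed.

(** [marks set0] needs no instruction: the store starts at 0 and reading never writes to table
    10. *)
Lemma wp_read_input Q :
  (forall s, loaded (store s) -> marks set0 (store s) -> sout s = [::] ->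
     Q s) ->
  wp N read_input [::] Q (State (fun=> 0) (encode_instance I) [::]).
Proof.
move=> HQ.
do 4![apply: wp_seq; apply: wp_input; [by bounds | reflexivity | rewrite /=]].
set h0 := upd _ _ _; set tas := flatten [seq encode_ta t | t <- _].
have H0 : header h0 by rewrite /header /h0 /upd !npair_eq.
have D0 i j : h0 (pr 10 i j) = 0 by rewrite /h0 /upd !npair_eq.
clearbody h0.
pose J c s := [/\ header (store s), values_loaded c (store s),
  forall i j, store s (pr 10 i j) = 0,
  sin s = flatten [seq encode_course x | x <- drop c (enum 'I_n)] ++ tas
  & sout s = [::]].
have frame a h i j v : 3 < a -> header h -> header (upd h (pr a i j) v).
  by move=> ha [? ? ? ?]; split; rewrite /upd npair_eq; case: eqP => //; lia.
apply: wp_seq; apply: (@wp_for n J); rewrite //=.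
- by bounds.
- by case: H0.
- by split=> //=; rewrite drop0.
- move=> x s [H V D S O]; rewrite drop_enum_ord /= in S.
  apply: wp_seq; apply: (wp_input _ S); first by bounds.
  apply: wp_seq; apply: wp_input; [by bounds | reflexivity | rewrite /=].
  rewrite -catA; set h1 := upd _ _ _.
  have H1 : header h1 by do 2!apply: frame => //.
  apply: (@wp_input_row 6 m (value x)) => //=.
  + by lia.
  + by bounds.
  + by case: H1.
  move=> h R F.
  have F' (b i' j' : nat) : (b != 4) && (b != 6) || (b == 6) && (i' != x) ->
      h (pr b i' j') = store s (pr b i' j').
    move=> hb; rewrite F; last by lia.
    by rewrite /h1 /upd !npair_eq; have -> : (b == 4) = false by lia.
  split=> //=.
  + by case: H => ? ? ? ?; split; rewrite F'.
  + move=> y t; rewrite ltn_ordS => /orP[/eqP->//|lt_y].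
    by rewrite F' ?V //= ltn_eqF.
  + by move=> i j; rewrite F'.
- move=> s1 [H1 V1 D1 S1 O1]; rewrite drop_enum_oversize /= in S1.
  pose K c s := [/\ header (store s), values_loaded n (store s),
    tas_loaded c (store s), forall i j, store s (pr 10 i j) = 0
    & sin s = flatten [seq encode_ta t | t <- drop c (enum 'I_m)] /\
      sout s = [::]].
  apply: (@wp_for m K); rewrite //=.
  + by bounds.
  + by case: H1.
  + by split=> //; rewrite drop0.
  + move=> t s [H V T D [S O]]; rewrite drop_enum_ord /= in S.
    apply: wp_seq; apply: (wp_input _ S); first by bounds.
    rewrite /= -!catA; set h1 := upd _ _ _.
    have H2 : header h1 by apply: frame.
    apply: wp_seq; apply: (@wp_input_row 7 n (util t)) => //=.
    * by lia.
    * by bounds.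
    * by case: H2.
    move=> h3 R3 F3.
    have H3 : header h3 by case: H2 => ? ? ? ?; split; rewrite F3.
    apply: wp_input_grades => //= h4 N4 D4 F4.
    have F' (b i' j' : nat) : (b != 4) && ((b < 7) || (9 < b)) ||
        (6 < b < 10) && (i' != t) -> h4 (pr b i' j') = store s (pr b i' j').
      move=> hb; rewrite F4; last by lia.
      rewrite F3; last by lia.
      by rewrite /h1 /upd !npair_eq; have -> : (b == 4) = false by lia.
    split=> //=.
    * by case: H => ? ? ? ?; split; rewrite F'.
    * by move=> x t' lt_x; rewrite F' ?V.
    * move=> t' x; rewrite ltn_ordS => /orP[/eqP->|lt_t].
        by rewrite F4 ?R3.
      by have [? ? ?] := T t' x lt_t; split; rewrite F' //= ltn_eqF.
    * by move=> i j; rewrite F'.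
  + move=> s [H V T D [_ O]]; apply: HQ => // t x.
    by rewrite D inE.
Qed.

(** A number out of range would become [None]; [best_at] rules this out. *)
Definition best_matching h : matching I := fun t =>
  if h (pr 12 t 0) is y.+1 then insub y else None.

Lemma best_matchingP h t :
  best_at (deleted I) h t n -> h (pr 12 t 0) =
  if best_matching h t is Some x then x.+1 else 0.
Proof.
rewrite /best_matching; case=> _ [[_ ->]//|[x [_ _ _ ->]]].
by rewrite valK.
Qed.

Lemma best_matching_best h :
  (forall t, best_at (deleted I) h t n) -> best_remaining (best_matching h).
Proof.
move=> B t; have [top] := B t; rewrite /best_matching.
case=> [[e ->] y u_gt0|[x [tx u_gt0 e ->]]].
  apply: contraLR u_gt0 => ty; rewrite -leqNgt -e; exact: top (ltn_ord y) ty.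
rewrite valK; split=> // y; rewrite -e; apply: contraLR => ty.
by rewrite -leqNgt; apply: top.
Qed.

Lemma count_enum (T : finType) (p : pred T) :
  count p (enum T) = #|[set x | p x]|.
Proof.
rewrite -sum1_count big_enum_cond -sum1_card.
by apply: eq_bigl => x; rewrite inE.
Qed.

Lemma wp_print_answer Q s :
  loaded (store s) -> (forall t, best_at (deleted I) (store s) t n) ->
  sout s = [::] ->
  let mu := best_matching (store s) in
  (forall s', sout s' = (if #|matched mu| == n then encode_matching mu
                         else encode_none) -> Q s') ->
  wp N print_answer [::] Q s.
Proof.
move=> L B O mu HQ; have eM t := best_matchingP (B t).
put; set h1 := upd _ _ _.
pose J c s' := [/\ loaded (store s'),
  forall t, store s' (pr 12 t 0) = if mu t is Some x then x.+1 else 0,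
  store s' (pr 5 0 0) = count (fun t => mu t : bool) (take c (enum 'I_m))
  & sout s' = [::]].
have L1 : loaded h1 by apply: loaded_upd.
apply: wp_seq; apply: (@wp_for m J); rewrite //=.
- by bounds.
- by case: L1 => -[].
- split=> //=; last by rewrite take0 /h1 /upd eqxx.
  by move=> t; rewrite /h1 /upd !npair_eq; apply: eM.
- move=> t s1 [L2 M2 C2 O2].
  have C3 : count (fun t => mu t : bool) (take t.+1 (enum 'I_m)) =
      store s1 (pr 5 0 0) + mu t.
    by rewrite take_enum_ord -cats1 count_cat /= addn0 C2.
  apply: wp_unless; rewrite /= ?M2; first by bounds.
    case mut: (mu t) => [x|] // _; put; split=> //=.
    + exact: loaded_upd.
    + by move=> t'; rewrite /upd !npair_eq; apply: M2.
    + by rewrite C3 mut /upd eqxx.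
  case mut: (mu t) => [x|] // _; split=> //.
  by rewrite C3 mut addn0.
move=> s1 [L2 M2 C2 O2]; rewrite take_oversize ?size_enum_ord // in C2.
rewrite count_enum -/(matched mu) in C2.
put; set h2 := upd _ _ _.
have L3 : loaded h2 by apply: loaded_upd.
have M3 t : h2 (pr 12 t 0) = if mu t is Some x then x.+1 else 0.
  by rewrite /h2 /upd !npair_eq; apply: M2.
have e3 : h2 (pr 4 0 0) = (#|matched mu| - n) + (n - #|matched mu|).
  by rewrite /h2 /upd eqxx C2; case: L2 => -[-> _ _ _] _ _.
apply: wp_seq; apply: wp_unless; rewrite /= ?e3; first by bounds.
  move=> full; apply: wp_seq; apply: wp_output; first by bounds.
  pose K c s' := store s' = h2 /\ sout s' =
    1 :: [seq (if mu t is Some x then x.+1 else 0) | t <- take c (enum 'I_m)].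
  apply: (@wp_for m K); rewrite //=.
  - by bounds.
  - by case: L3 => -[].
  - by split=> //=; rewrite take0 O2.
  - move=> t s3 [S3 O3]; apply: wp_output; first by bounds.
    split=> //=; rewrite take_enum_ord map_rcons -rcons_cons -O3.
    by rewrite S3 M3.
  move=> s3 [S3 O3]; rewrite take_oversize ?size_enum_ord // in O3.
  apply: wp_unless; rewrite /= S3 ?e3 ?full //; first by bounds.
  by move=> _; apply: HQ; rewrite O3 ifT //; lia.
move=> nfull; apply: wp_unless; rewrite /= ?e3; first by bounds.
  move=> _; apply: wp_output; first by bounds.
  apply: HQ; rewrite /= O2 ifF //; apply: contraTF nfull => /eqP->.
  by rewrite subnn.
by move=> ?; exfalso; lia.
Qed.

Lemma wp_solver : unit_capacities I -> distinct_valuations I ->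
  wp N solver [::] (fun s => @mefe_answer I (sout s))
    (State (fun=> 0) (encode_instance I) [::]).
Proof.
move=> cap1 distinct; apply: wp_seq; apply: wp_read_input => s L M O.
pose J c s' := [/\ loaded (store s'),
  marks (iter c (@deletion I) set0) (store s') & sout s' = [::]].
apply: wp_seq; apply: (@wp_for (m * n) J); rewrite //=.
- bounds => /=; case: L => -[-> _ _ _] _ _.
  exact: leq_ltn_trans small_courses (ltn_expl _ _).
- by case: L => -[-> -> _ _].
- by case/andP: small_rounds.
- move=> c s1 [L1 M1 O1]; apply: wp_seq.
  apply: (wp_find_best _ L1 M1) => s2 L2 M2 B2 O2.
  apply: (wp_delete_pairs _ L2 B2) => s3 L3 M3 O3.
  by split=> //; rewrite O3 O2.
move=> s1 [L1 M1 O1]; apply: wp_seq.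
(* The loop count [m * n] is the cardinality of the type of pairs, the number of iterations in
   [fixset]. *)
have M1' : marks (deleted I) (store s1).
  by rewrite /deleted /fixset card_prod !card_ord.
apply: (wp_find_best _ L1 M1') => s2 L2 M2 B2 O2.
apply: wp_print_answer => //; first by rewrite O2.
move=> s3 ->; apply: best_answer => //; exact: best_matching_best.
Qed.

End Correctness.

(** * Input size *)

Lemma size_le_bitsize w : size w <= bitsize w.
Proof. by elim: w => //= a w IHw; rewrite -add1n leq_add. Qed.

Lemma mem_ltn_bitsize w a : a \in w -> a < 2 ^ bitsize w.
Proof.
elim: w => // b w IHw; rewrite inE => /orP[/eqP<-|/IHw lt_a].
  apply: leq_trans (trunc_log_ltn a (leqnn 2)) _.
  by rewrite leq_pexp2l ?leq_addr.
by apply: leq_trans lt_a _; rewrite leq_pexp2l ?leq_addl.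
Qed.

Lemma size_flatten_geq (T S : Type) c (f : T -> seq S) r :
  (forall x, c <= size (f x)) ->
  size r * c <= size (flatten [seq f x | x <- r]).
Proof.
move=> fc; elim: r => //= x r IHr.
by rewrite mulSn size_cat leq_add.
Qed.

Section InputSize.

Variable I : mefe_instance.
Local Notation n := (ncourses I).
Local Notation m := (ntas I).

(** Course blocks contribute [n * (2 + m)] entries, and TA blocks at least [m] through their leading
    indices. *)
Lemma size_encode_instance :
  m + n + m * n <= bitsize (encode_instance I).
Proof.
apply: leq_trans (size_le_bitsize _); rewrite /encode_instance !size_cat.
have sizeC := @size_flatten_geq _ _ (2 + m) (@encode_course I) (enum 'I_n).
have sizeT := @size_flatten_geq _ _ 1 (@encode_ta I) (enum 'I_m).
rewrite !size_enum_ord in sizeC sizeT.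
have {}sizeT := sizeT (fun=> isT).
have /sizeC : forall x, 2 + m <= size (@encode_course I x).
  by move=> x; rewrite /= size_map size_enum_ord.
by lia.
Qed.

Lemma denq_threshold_encoded :
  `|denq (threshold I)|%N \in encode_instance I.
Proof. by rewrite /encode_instance !mem_cat !inE eqxx !orbT. Qed.

Lemma denq_grade_encoded (t : 'I_m) (x : 'I_n) :
  `|denq (grade t x)|%N \in encode_instance I.
Proof.
rewrite /encode_instance !mem_cat; do 3!(apply/orP; right).
apply/flatten_mapP; exists t; first by rewrite mem_enum.
rewrite /encode_ta inE mem_cat; do 2!(apply/orP; right).
apply/flatten_mapP; exists x; first by rewrite mem_enum.
by rewrite !inE eqxx orbT.
Qed.

End InputSize.

Theorem theorem5 :
  polytime_solvable encode_instance
    (fun I : mefe_instance => unit_capacities I /\ distinct_valuations I)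
    mefe_answer.
Proof.
(* With 16, [N] is at least [12 + 4 * (S * S) + S]. This covers the tag 12, the value of [npair i j]
   for [i] and [j] up to [S], and the number of rounds. *)
apply: (@polytime_of_cmd _ _ _ _ solver 16) => I [cap1 distinct].
set N := 16 * _; set S := bitsize (encode_instance I) in N *.
have leS : ntas I + ncourses I + ntas I * ncourses I <= S.
  exact: size_encode_instance.
have leN : 12 + 4 * (S * S) + S <= N by rewrite /N expnS expn1; lia.
have bits a : a \in encode_instance I -> a < 2 ^ N.
  move/mem_ltn_bitsize/leq_trans; apply.
  by rewrite leq_pexp2l // -/S; lia.
apply: wp_solver => // [a i j ha hi hj||t x|].
- have lt_small k : k <= N -> k < 2 ^ N.
    by move=> kN; apply: leq_ltn_trans kN (ltn_expl _ _).
  have ij : i + j <= 2 * S by lia.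
  by apply/andP; split; apply: lt_small; rewrite /npair; nia.
- by apply/andP; split; lia.
- exact/bits/denq_grade_encoded.
- exact/bits/denq_threshold_encoded.
Qed.
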